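(* Let $L,K$ be strictly concave kernel functions such that either $K$ satisfies condition $(\infty')$, or both $K$ and $L$ belong to $\mathrm{C}^1(0,2\pi)$. For $\mathbf{y}=(y_1,\dots,y_n)\in\mathbb{T}^n$ set $F(\mathbf{y},t)=L(t)+\sum_{j=1}^nK(t-y_j)$. Then there is a $\mathbf{w}^*=(w_1,\dots,w_n)\in\mathbb{T}^n$, unique up to permutation of its coordinates, with \[M:=\inf_{\mathbf{y}\in\mathbb{T}^n}\sup_{t\in\mathbb{T}}F(\mathbf{y},t)=\sup_{t\in\mathbb{T}}F(\mathbf{w}^*,t).\] Moreover: (a) the nodes $w_0=0,w_1,\dots,w_n$ are pairwise different and $\mathbf{w}^*$ is an equioscillation point, $m_0(\mathbf{w}^* )=\dots=m_n(\mathbf{w}^* )$; (b) $M=\inf_{\mathbf{y}\in\mathbb{T}^n}\max_{j=0,\dots,n}\sup_{t\in I_j(\mathbf{y})}F(\mathbf{y},t)=\sup_{\mathbf{y}\in\mathbb{T}^n}\min_{j=0,\dots,n}\sup_{t\in I_j(\mathbf{y})}F(\mathbf{y},t)=m$; (c) the Sandwich Property holds on $\mathbb{T}^n$: for all $\mathbf{x},\mathbf{y}\in\mathbb{T}^n$, $\underline{m}(\mathbf{x})\le m=M\le\overline{m}(\mathbf{y})$; (d) if moreover $L=K$, then the points $w_0=0,w_1,\dots,w_n$ are, after a permutation, equidistantly spaced in $\mathbb{T}$.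
   Context: Identify the torus $\mathbb{T}=\mathbb{R}/2\pi\mathbb{Z}$ with $[0,2\pi)$. A concave kernel function is a $2\pi$-periodic function $K:\mathbb{R}\to[-\infty,\infty)$ which is real-valued and concave on $(0,2\pi)$ and such that $\lim_{t\downarrow0}K(t)$ and $\lim_{t\uparrow2\pi}K(t)$ exist in $[-\infty,\infty)$ and are equal; it is strictly concave if strictly concave on $(0,2\pi)$. $D_\pm$ denote one-sided derivatives. Condition $(\infty')$ for $K$: either $\lim_{t\uparrow2\pi}D_-K(t)=\lim_{t\uparrow2\pi}D_+K(t)=-\infty$, or $\lim_{t\downarrow0}D_-K(t)=\lim_{t\downarrow0}D_+K(t)=+\infty$. For $\mathbf{y}\in\mathbb{T}^n$ put $y_0=0$, $y_{n+1}=2\pi$. For a permutation $\sigma$ of $\{1,\dots,n\}$ (with $\sigma(0)=0,\sigma(n+1)=n+1$) the closed simplex $\overline{S_\sigma}$ is the set of $\mathbf{y}$ with $0\le y_{\sigma(1)}\le\dots\le y_{\sigma(n)}\le2\pi$; for such $\mathbf{y}$ and $k=0,\dots,n$, $I_{\sigma(k)}(\mathbf{y})=[y_{\sigma(k)},y_{\sigma(k+1)}]$ and $m_{\sigma(k)}(\mathbf{y})=\sup_{t\in I_{\sigma(k)}(\mathbf{y})}F(\mathbf{y},t)$. For each $\mathbf{y}$ some $\sigma$ with $\mathbf{y}\in\overline{S_\sigma}$ is chosen; the quantities $\overline{m}(\mathbf{y})=\max_jm_j(\mathbf{y})=\sup_{t\in\mathbb{T}}F(\mathbf{y},t)$ and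 $\underline{m}(\mathbf{y})=\min_jm_j(\mathbf{y})$ do not depend on this choice. $m:=\sup_{\mathbf{y}\in\mathbb{T}^n}\underline{m}(\mathbf{y})$. An equioscillation point is a $\mathbf{y}$ with $m_0(\mathbf{y})=\dots=m_n(\mathbf{y})$.
   Formalization: The value of each kernel function at 0 (and at multiples of 2π) is required to equal its common one-sided limit there; with an arbitrary value at 0, e.g. one above the limit, part (a) can fail. *)

(* Defs.v *)
From Stdlib Require Import Reals Lra ClassicalEpsilon.
From Coquelicot Require Import Coquelicot.
Open Scope R_scope.

(* real part of a kernel (meaningful on (0,2pi), where kernels are real-valued) *)
Definition Kr (K : R -> Rbar) (t : R) : R := real (K t).

Definition in_open (t : R) : Prop := 0 < t < 2 * PI.

Definition is_lderiv (f : R -> R) (t d : R) : Prop :=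
  filterlim (fun h => (f (t + h) - f t) / h) (at_left 0) (locally d).
Definition is_rderiv (f : R -> R) (t d : R) : Prop :=
  filterlim (fun h => (f (t + h) - f t) / h) (at_right 0) (locally d).

(* Concave kernel function: 2pi-periodic, values in [-oo,+oo), real-valued and
   concave on (0,2pi), one-sided limits at 0+ and 2pi- exist in [-oo,+oo),
   are equal, and (convention of the paper) K(0) is this common limit. *)
Definition concave_kernel (K : R -> Rbar) : Prop :=
  (forall t, K (t + 2 * PI) = K t) /\
  (forall t, K t <> p_infty) /\
  (forall t, in_open t -> is_finite (K t)) /\
  (forall x y l, in_open x -> in_open y -> 0 <= l <= 1 ->
     l * Kr K x + (1 - l) * Kr K y <= Kr K (l * x + (1 - l) * y)) /\
  exists lim0 : Rbar, lim0 <> p_infty /\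
     filterlim (Kr K) (at_right 0) (Rbar_locally lim0) /\
     filterlim (Kr K) (at_left (2 * PI)) (Rbar_locally lim0) /\
     K 0 = lim0.

Definition strictly_concave_kernel (K : R -> Rbar) : Prop :=
  concave_kernel K /\
  (forall x y l, in_open x -> in_open y -> x <> y -> 0 < l < 1 ->
     l * Kr K x + (1 - l) * Kr K y < Kr K (l * x + (1 - l) * y)).

Definition cond_infty' (K : R -> Rbar) : Prop :=
  (exists dm dp : R -> R,
     (forall t, in_open t -> is_lderiv (Kr K) t (dm t) /\ is_rderiv (Kr K) t (dp t)) /\
     filterlim dm (at_left (2 * PI)) (Rbar_locally m_infty) /\
     filterlim dp (at_left (2 * PI)) (Rbar_locally m_infty))
  \/
  (exists dm dp : R -> R,
     (forall t, in_open t -> is_lderiv (Kr K) t (dm t) /\ is_rderiv (Kr K) t (dp t)) /\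
     filterlim dm (at_right 0) (Rbar_locally p_infty) /\
     filterlim dp (at_right 0) (Rbar_locally p_infty)).

Definition C1_open (K : R -> Rbar) : Prop :=
  exists dK : R -> R, forall t, in_open t ->
    is_derive (Kr K) t (dK t) /\ continuous dK t.

(* Points of T^n: y : nat -> R, coordinates y 1, ..., y n in [0,2pi). *)
Definition inT (n : nat) (y : nat -> R) : Prop :=
  forall j, (1 <= j <= n)%nat -> 0 <= y j < 2 * PI.

Definition ext (n : nat) (y : nat -> R) (j : nat) : R :=
  if Nat.eqb j 0 then 0 else if Nat.eqb j (S n) then 2 * PI else y j.

Fixpoint sumK (K : R -> Rbar) (y : nat -> R) (t : R) (n : nat) : Rbar :=
  match n with
  | O => Finite 0
  | S k => Rbar_plus (sumK K y t k) (K (t - y (S k)))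
  end.

Definition F (L K : R -> Rbar) (n : nat) (y : nat -> R) (t : R) : Rbar :=
  Rbar_plus (L t) (sumK K y t n).

Definition supB {A : Type} (P : A -> Prop) (f : A -> Rbar) : Rbar :=
  Rbar_lub (fun v => exists x, P x /\ v = f x).
Definition infB {A : Type} (P : A -> Prop) (f : A -> Rbar) : Rbar :=
  Rbar_glb (fun v => exists x, P x /\ v = f x).

Definition maxk (n : nat) (f : nat -> Rbar) : Rbar := supB (fun k => (k <= n)%nat) f.
Definition mink (n : nat) (f : nat -> Rbar) : Rbar := infB (fun k => (k <= n)%nat) f.

Definition perm_on (n : nat) (s : nat -> nat) : Prop :=
  (forall j, (1 <= j <= n)%nat -> (1 <= s j <= n)%nat) /\
  (forall i j, (1 <= i <= n)%nat -> (1 <= j <= n)%nat -> s i = s j -> i = j).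

Definition sext (n : nat) (s : nat -> nat) (k : nat) : nat :=
  if Nat.eqb k 0 then 0%nat else if Nat.eqb k (S n) then S n else s k.

Definition is_sorting (n : nat) (y : nat -> R) (s : nat -> nat) : Prop :=
  perm_on n s /\
  forall k, (k <= n)%nat -> ext n y (sext n s k) <= ext n y (sext n s (S k)).

Definition sort_perm (n : nat) (y : nat -> R) : nat -> nat :=
  epsilon (inhabits (fun k => k)) (fun s => is_sorting n y s).

(* m_{sigma(k)}(y) = sup over I_{sigma(k)}(y) = [y_{sigma(k)}, y_{sigma(k+1)}] of F(y,.) *)
Definition msig (L K : R -> Rbar) (n : nat) (y : nat -> R) (s : nat -> nat) (k : nat) : Rbar :=
  supB (fun t => ext n y (sext n s k) <= t <= ext n y (sext n s (S k))) (F L K n y).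

Definition mbar_intervals L K n y : Rbar := maxk n (msig L K n y (sort_perm n y)).
Definition munder L K n y : Rbar := mink n (msig L K n y (sort_perm n y)).

Definition supF L K n y : Rbar := supB (fun t => 0 <= t < 2 * PI) (F L K n y).

Definition bigM L K n : Rbar := infB (inT n) (supF L K n).
Definition smallm L K n : Rbar := supB (inT n) (munder L K n).

(* Main.v *)
Require Import Defs.
From Stdlib Require Import Reals Lra Lia List Permutation Sorted Classical ClassicalEpsilon.
From Coquelicot Require Import Coquelicot.
Open Scope R_scope.

(** For a sorted node vector [y] and [t] in its [j]-th arc, [F y t] is jointly strictly concave in
    [(y, t)], so each arc maximum [m_j] is a strictly concave function of [y] on the simplex.

    A minimiser [w] of [sup F] exists by compactness.  Its maxima are never attained at a node of [K],
    where [K] has a downward kink.  If at most [n] arcs were active at [w], their supergradients would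
    admit a common non-ascent direction (there are [n] free nodes), and strict concavity would make
    [sup F] smaller: hence all [n + 1] arcs are nondegenerate and active, i.e. [w] equioscillates.

    If some [x <> w] had [m_j x >= M] for all [j], then by concavity every [m_j] would be below [M] at
    points slightly beyond [w] on the line from [x], contradicting minimality.  This gives both
    [m <= M] and uniqueness.  For [L = K], rotating the configuration by [w_1] yields another minimiser,
    and uniqueness forces equal spacing.

    The topological arguments use [exp F], which is real-valued and continuous even where [F = -oo]. *)

(** Under condition (oo') the kernels may fail to be differentiable, and a minimiser given by
    compactness may a priori have coinciding nodes, so that a perturbation of it can leave the
    simplex of sorted vectors or even the period. Hence [in_arc] fixes the branch of every translate
    of [K] without ordering the nodes; it survives small perturbations once [t] is off the nodes of
    [K], and this is what the kink provides.

    Gradients are replaced by a splitting: at a maximum point [z] of [F w], one supergradient [k i]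
    per translate of [K] can be chosen so that [- sm k n] is a supergradient of [L] at [z].
    Displacing the nodes by [d] then lowers the arc maximum by at least [sm (fun i => k i * d i) n],
    wherever on the arc the new maximum point lies. The point 0, the node of [L], is not excluded as
    a maximum point; therefore [L] is the one term that is allowed to have [z] at an endpoint of its
    domain. *)

Lemma choice {A B : Type} (P : A -> B -> Prop) :
  (forall x, exists y, P x y) -> exists f : A -> B, forall x, P x (f x).
Proof.
intros H. exists (fun x => proj1_sig (constructive_indefinite_description _ (H x))).
intros x. apply (proj2_sig (constructive_indefinite_description _ (H x))).
Qed.

(** * Concave functions of one variable *)

(* [p_infty], which kernels never take, is sent to the junk value [0]. *)
Definition ebar (x : Rbar) : R := match x with Finite r => exp r | _ => 0 end.

Lemma ebar_ge0 x : 0 <= ebar x.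
Proof. destruct x; simpl; try lra. left; apply exp_pos. Qed.

Lemma ebar_pos x : 0 < ebar x -> ebar x = exp (real x) /\ is_finite x.
Proof. destruct x; simpl; intros; try lra. split; [easy|reflexivity]. Qed.

Lemma ebar_le x y : x <> p_infty -> y <> p_infty -> (Rbar_le x y <-> ebar x <= ebar y).
Proof.
destruct x as [x| |]; destruct y as [y| |]; simpl; intros Hx Hy; try congruence; split; intros H; try easy; try lra.
- destruct H as [H|H]; [left; now apply exp_increasing | right; now rewrite H].
- destruct H as [H|H]; [left; now apply exp_lt_inv | right; now apply exp_inv].
- pose proof (exp_pos x); lra.
- left; apply exp_pos.
Qed.

Lemma ebar_plus x y : x <> p_infty -> y <> p_infty ->
  ebar (Rbar_plus x y) = ebar x * ebar y /\ Rbar_plus x y <> p_infty.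
Proof.
destruct x as [x| |]; destruct y as [y| |]; simpl; intros Hx Hy; try congruence; split; try easy; try ring.
apply exp_plus.
Qed.

Definition periodic {A : Type} (f : R -> A) : Prop := forall t, f (t + 2 * PI) = f t.

Lemma two_PI_pos : 0 < 2 * PI.
Proof. pose proof PI_RGT_0; lra. Qed.

Lemma periodic_nat {A : Type} (f : R -> A) (k : nat) t :
  periodic f -> f (t + INR k * (2 * PI)) = f t.
Proof.
intros Hf; induction k as [|k IH]; [now rewrite Rmult_0_l, Rplus_0_r|].
rewrite S_INR, <- IH, <- (Hf (t + INR k * (2 * PI))); f_equal; ring.
Qed.

(** The shift comes with its effect on all periodic functions at once, so that the same [c] serves
    both [ek] and [Kr] and no integer multiple has to be carried along. *)
Lemma periodic_reduce (r : R) : exists c, 0 <= r + c < 2 * PI /\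
  forall (A : Type) (f : R -> A), periodic f -> forall t, f (t + c) = f t.
Proof.
pose proof two_PI_pos as HP.
destruct (Rle_dec 0 r) as [H|H].
- destruct (nfloor_ex (r / (2 * PI))) as [k [Hk1 Hk2]].
  { apply Rdiv_le_0_compat; lra. }
  apply (Rmult_le_compat_r (2 * PI)) in Hk1; [|lra].
  apply (Rmult_lt_compat_r (2 * PI)) in Hk2; [|lra].
  replace (r / (2 * PI) * (2 * PI)) with r in * by (field; lra).
  exists (- (INR k * (2 * PI))); split; [lra|].
  intros A f Hf t. rewrite <- (periodic_nat f k _ Hf). f_equal; ring.
- destruct (nfloor_ex (- r / (2 * PI))) as [k [Hk1 Hk2]].
  { apply Rdiv_le_0_compat; lra. }
  apply (Rmult_lt_compat_r (2 * PI)) in Hk2; [|lra].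
  apply (Rmult_le_compat_r (2 * PI)) in Hk1; [|lra].
  replace (- r / (2 * PI) * (2 * PI)) with (- r) in * by (field; lra).
  (* If [- r] is an exact multiple of the period, one more period would land on the excluded right
     end. *)
  destruct (Rle_lt_or_eq_dec _ _ Hk1) as [Hlt|Heq].
  + exists (INR (S k) * (2 * PI)); split; [rewrite S_INR; lra|].
    intros A f Hf t. now apply periodic_nat.
  + exists (INR k * (2 * PI)); split; [lra|].
    intros A f Hf t. now apply periodic_nat.
Qed.

(** Convexity of the domain is part of the notion: slopes are compared at intermediate points, which
    must lie in [D]. *)
Definition concave_on (D : R -> Prop) (f : R -> R) : Prop :=
  forall x y l, D x -> D y -> 0 <= l <= 1 ->
    D (l * x + (1 - l) * y) /\ l * f x + (1 - l) * f y <= f (l * x + (1 - l) * y).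

(** Multiplying the chord inequality by [(y - x) ^ 2] lets one statement cover both orders of [x]
    and [y] and the case [x = y]. *)
Lemma concave_on_scaled (D : R -> Prop) f x y v :
  concave_on D f -> D x -> D y -> x <= v <= y \/ y <= v <= x ->
  D v /\ (v - x) * (f y - f x) * (y - x) <= (f v - f x) * (y - x) ^ 2.
Proof.
intros Hc Hx Hy Hv.
destruct (Req_dec x y) as [E|E].
- subst y. assert (v = x) by lra. subst v. split; [easy|]. right; ring.
- destruct (Hc x y ((y - v) / (y - x)) Hx Hy) as [H1 H2].
  + destruct Hv as [Hv|Hv].
    * split; [apply Rdiv_le_0_compat; lra|]. apply Rle_div_l; lra.
    * replace ((y - v) / (y - x)) with ((v - y) / (x - y)) by (field; lra).
      split; [apply Rdiv_le_0_compat; lra|]. apply Rle_div_l; lra.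
  + replace ((y - v) / (y - x) * x + (1 - (y - v) / (y - x)) * y) with v in * by (field; lra).
    split; [easy|].
    replace ((v - x) * (f y - f x) * (y - x)) with
      (((y - v) / (y - x) * f x + (1 - (y - v) / (y - x)) * f y - f x) * (y - x) ^ 2) by (field; lra).
    apply Rmult_le_compat_r; [nra|lra].
Qed.

Lemma concave_slope_right (D : R -> Prop) f z v u :
  concave_on D f -> D z -> D u -> z < v <= u -> D v /\ (f u - f z) / (u - z) <= (f v - f z) / (v - z).
Proof.
intros Hc Hz Hu Hv.
destruct (concave_on_scaled D f z u v Hc Hz Hu) as [H1 H2]; [lra|]. split; [easy|].
apply Rle_div_l; [lra|].
replace ((f v - f z) / (v - z) * (u - z)) with ((f v - f z) * (u - z) / (v - z)) by (field; lra).
apply Rle_div_r; [lra|].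
apply (Rmult_le_reg_r (u - z)); nra.
Qed.

Lemma concave_slope_left (D : R -> Prop) f z v u :
  concave_on D f -> D z -> D u -> u <= v < z -> D v /\ (f v - f z) / (v - z) <= (f u - f z) / (u - z).
Proof.
intros Hc Hz Hu Hv.
assert (Hc' : concave_on (fun x => D (- x)) (fun x => f (- x))).
{ intros x y l Hx Hy Hl. destruct (Hc _ _ l Hx Hy Hl) as [A B].
  replace (- (l * x + (1 - l) * y)) with (l * - x + (1 - l) * - y) by ring. easy. }
destruct (concave_slope_right _ _ (- z) (- v) (- u) Hc') as [H1 H2]; rewrite ?Ropp_involutive; try easy; try lra.
rewrite !Ropp_involutive in *. split; [easy|].
replace ((f v - f z) / (v - z)) with (- ((f v - f z) / (- v - - z))) by (field; lra).
replace ((f u - f z) / (u - z)) with (- ((f u - f z) / (- u - - z))) by (field; lra).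
lra.
Qed.

Lemma concave_slope_between (D : R -> Prop) f z u v :
  concave_on D f -> D u -> D v -> u < z < v -> (f v - f z) / (v - z) <= (f u - f z) / (u - z).
Proof.
intros Hc Hu Hv Huv.
destruct (concave_on_scaled D f u v z Hc Hu Hv) as [H1 H2]; [lra|].
apply Rle_div_l; [lra|].
replace ((f u - f z) / (u - z) * (v - z)) with ((f z - f u) * (v - z) / (z - u)) by (field; lra).
apply Rle_div_r; [lra|].
apply (Rmult_le_reg_r (v - u)); nra.
Qed.

(* One-dimensional separation: at a maximum of [f + g], the supergradients of
   [g] and of [- f] at [z] have a common element. *)
Lemma concave_separation (Df Dg : R -> Prop) f g z u1 u2 :
  concave_on Df f -> concave_on Dg g -> Df z -> Dg z ->
  u1 < z < u2 -> Dg u1 -> Dg u2 ->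
  (forall t, Df t -> Dg t -> f t + g t <= f z + g z) ->
  exists k, (forall u, Dg u -> g u <= g z + k * (u - z)) /\
            (forall t, Df t -> f t <= f z - k * (t - z)).
Proof.
intros Hf Hg Zf Zg Hz H1 H2 Hmax.
(* [E] collects the lower bounds imposed on [k]: slopes of [g] to the right of [z] and negated
   slopes of [f] to its left. The upper bounds are the slopes on the opposite sides, and [k] is the
   supremum of [E]. The points [u1] and [u2] make [E] bounded and nonempty, so [z] may be an
   endpoint of [Df]. *)
pose (E := fun s => (exists u, Dg u /\ z < u /\ s = (g u - g z) / (u - z)) \/
                    (exists t, Df t /\ t < z /\ s = - ((f t - f z) / (t - z)))).
assert (HE1 : forall s u, E s -> Dg u -> u < z -> s <= (g u - g z) / (u - z)).
{ intros s u [(v & Hv & Hv' & ->)|(t & Ht & Ht' & ->)] Hu Hu'.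
  - apply concave_slope_between with Dg; auto.
  (* Both slopes are moved to the common point [v], at least as near to [z], where the maximality of
     [f + g] relates them. *)
  - pose (v := Rmax u t).
    assert (Hv : u <= v < z /\ t <= v < z).
    { unfold v; split; split; try apply Rmax_l; try apply Rmax_r; apply Rmax_lub_lt; lra. }
    destruct (concave_slope_left Dg g z v u Hg Zg Hu) as [A B]; [tauto|].
    destruct (concave_slope_left Df f z v t Hf Zf Ht) as [A' B']; [tauto|].
    specialize (Hmax v A' A).
    assert (0 <= (f v - f z) / (v - z) + (g v - g z) / (v - z)); [|lra].
    replace ((f v - f z) / (v - z) + (g v - g z) / (v - z)) with ((f z + g z - (f v + g v)) / (z - v)) by (field; lra).
    apply Rdiv_le_0_compat; lra. }
assert (HE2 : forall s t, E s -> Df t -> z < t -> s <= - ((f t - f z) / (t - z))).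
{ intros s t [(u & Hu & Hu' & ->)|(v & Hv & Hv' & ->)] Ht Ht'.
  - pose (v := Rmin u t).
    assert (Hv : z < v <= u /\ z < v <= t).
    { unfold v; split; split; try apply Rmin_l; try apply Rmin_r; apply Rmin_glb_lt; lra. }
    destruct (concave_slope_right Dg g z v u Hg Zg Hu) as [A B]; [tauto|].
    destruct (concave_slope_right Df f z v t Hf Zf Ht) as [A' B']; [tauto|].
    specialize (Hmax v A' A).
    assert ((f v - f z) / (v - z) + (g v - g z) / (v - z) <= 0); [|lra].
    replace ((f v - f z) / (v - z) + (g v - g z) / (v - z)) with (- ((f z + g z - (f v + g v)) / (v - z))) by (field; lra).
    assert (0 <= (f z + g z - (f v + g v)) / (v - z)) by (apply Rdiv_le_0_compat; lra). lra.
  - apply Ropp_le_contravar. apply concave_slope_between with Df; auto. }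
destruct (completeness E) as [k [Hk1 Hk2]].
- exists ((g u1 - g z) / (u1 - z)). intros s Hs. apply HE1; easy.
- exists ((g u2 - g z) / (u2 - z)). left. exists u2. repeat split; try easy; lra.
- exists k; split.
  + intros u Hu. destruct (Rtotal_order u z) as [H|[->|H]]; [|right; ring|].
    * assert (k <= (g u - g z) / (u - z)) as A by (apply Hk2; intros s Hs; now apply HE1).
      replace ((g u - g z) / (u - z)) with ((g z - g u) / (z - u)) in A by (field; lra).
      apply Rle_div_r in A; lra.
    * assert ((g u - g z) / (u - z) <= k) as A by (apply Hk1; left; now exists u).
      apply Rle_div_l in A; lra.
  + intros t Ht. destruct (Rtotal_order t z) as [H|[->|H]]; [|right; ring|].
    * assert (- ((f t - f z) / (t - z)) <= k) as A by (apply Hk1; right; now exists t).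
      replace (- ((f t - f z) / (t - z))) with ((f t - f z) / (z - t)) in A by (field; lra).
      apply Rle_div_l in A; lra.
    * assert (k <= - ((f t - f z) / (t - z))) as A by (apply Hk2; intros s Hs; now apply HE2).
      replace (- ((f t - f z) / (t - z))) with ((f z - f t) / (t - z)) in A by (field; lra).
      apply Rle_div_r in A; lra.
Qed.

Fixpoint sm (f : nat -> R) (n : nat) : R :=
  match n with O => 0 | S k => sm f k + f (S k) end.

Lemma sm_ext f g n : (forall i, (1 <= i <= n)%nat -> f i = g i) -> sm f n = sm g n.
Proof. induction n; simpl; intros H; [easy|]. rewrite IHn, H; auto; intros; try apply H; lia. Qed.

Lemma sm_le f g n : (forall i, (1 <= i <= n)%nat -> f i <= g i) -> sm f n <= sm g n.
Proof.
induction n; simpl; intros H; [lra|].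
apply Rplus_le_compat; [apply IHn; intros; apply H; lia | apply H; lia].
Qed.

Lemma sm_lt f g n k : (forall i, (1 <= i <= n)%nat -> f i <= g i) ->
  (1 <= k <= n)%nat -> f k < g k -> sm f n < sm g n.
Proof.
induction n; simpl; intros H Hk Hlt; [lia|].
destruct (Nat.eq_dec k (S n)) as [->|E].
- apply Rplus_le_lt_compat; [apply sm_le; intros; apply H; lia|easy].
- apply Rplus_lt_le_compat; [apply IHn; [intros; apply H; lia|lia|easy]|apply H; lia].
Qed.

Lemma sm_lin a b f g n : sm (fun i => a * f i + b * g i) n = a * sm f n + b * sm g n.
Proof. induction n; simpl; [ring|]. rewrite IHn; ring. Qed.

Lemma concave_on_add (D E : R -> Prop) f g :
  concave_on D f -> concave_on E g -> concave_on (fun t => D t /\ E t) (fun t => f t + g t).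
Proof.
intros Hf Hg x y l [Hx Hx'] [Hy Hy'] Hl.
destruct (Hf x y l Hx Hy Hl), (Hg x y l Hx' Hy' Hl). split; [easy|lra].
Qed.

Lemma concave_on_sm (D : nat -> R -> Prop) (g : nat -> R -> R) n :
  (forall i, (1 <= i <= n)%nat -> concave_on (D i) (g i)) ->
  concave_on (fun t => forall i, (1 <= i <= n)%nat -> D i t) (fun t => sm (fun i => g i t) n).
Proof.
intros H x y l Hx Hy Hl. split.
- intros i Hi. apply (H i Hi x y l); auto.
- rewrite <- sm_lin. apply sm_le. intros i Hi. apply (H i Hi x y l); auto.
Qed.

(** Summands are split off one at a time: the slope [k0] found for the last one is added to [f] as a
    linear term, and the shorter sum is again maximal at [z]. Only the [g i] need points of their
    domains on both sides of [z]. *)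
Lemma concave_separation_sum (D : nat -> R -> Prop) (g : nat -> R -> R) (Df : R -> Prop) (z : R) n :
  forall f : R -> R,
  concave_on Df f -> (forall i, (1 <= i <= n)%nat -> concave_on (D i) (g i)) ->
  Df z -> (forall i, (1 <= i <= n)%nat -> D i z /\ exists u1 u2, u1 < z < u2 /\ D i u1 /\ D i u2) ->
  (forall t, Df t -> (forall i, (1 <= i <= n)%nat -> D i t) ->
     f t + sm (fun i => g i t) n <= f z + sm (fun i => g i z) n) ->
  exists k : nat -> R,
    (forall i u, (1 <= i <= n)%nat -> D i u -> g i u <= g i z + k i * (u - z)) /\
    (forall t, Df t -> f t <= f z - sm k n * (t - z)).
Proof.
induction n as [|n IH]; intros f Hf Hg Zf Zg Hmax.
- exists (fun _ => 0); split; [intros; lia|]. intros t Ht; simpl.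
  specialize (Hmax t Ht). simpl in Hmax. assert (f t + 0 <= f z + 0) by (apply Hmax; intros; lia). lra.
- destruct (Zg (S n)) as [ZS (u1 & u2 & Hu & Hu1 & Hu2)]; [lia|].
  destruct (concave_separation (fun t => Df t /\ forall i, (1 <= i <= n)%nat -> D i t) (D (S n))
    (fun t => f t + sm (fun i => g i t) n) (g (S n)) z u1 u2) as (k0 & Hk1 & Hk2); auto.
  + apply concave_on_add; [easy|]. apply concave_on_sm. intros; apply Hg; lia.
  + apply Hg; lia.
  + split; [easy|]. intros i Hi; apply Zg; lia.
  + intros t [Ht Ht'] Ht2. specialize (Hmax t Ht). simpl in Hmax. rewrite !Rplus_assoc. apply Hmax.
    intros i Hi. destruct (Nat.eq_dec i (S n)) as [->|]; [easy|apply Ht'; lia].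
  + destruct (IH (fun t => f t + k0 * (t - z))) as (k & Hk3 & Hk4); auto.
    * intros x y l Hx Hy Hl. destruct (Hf x y l Hx Hy Hl). split; [easy|]. nra.
    * intros i Hi; apply Hg; lia.
    * intros i Hi; apply Zg; lia.
    * intros t Ht Ht'. specialize (Hk2 t (conj Ht Ht')). simpl in Hk2. lra.
    * exists (fun i => if Nat.eqb i (S n) then k0 else k i). split.
      -- intros i u Hi Hu'. destruct (Nat.eqb_spec i (S n)) as [->|]; [now apply Hk1|apply Hk3; [lia|easy]].
      -- intros t Ht. simpl. rewrite Nat.eqb_refl.
         rewrite (sm_ext _ k). 2:{ intros i Hi. destruct (Nat.eqb_spec i (S n)); [lia|easy]. }
         specialize (Hk4 t Ht). simpl in Hk4. nra.
Qed.

(** * Concave kernels *)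

(** By monotonicity of slopes, all difference quotients at [z] with steps up to [r] lie between the
    quotients with steps [r] and [- r]. *)
Lemma concave_local_lipschitz (D : R -> Prop) f z r :
  concave_on D f -> 0 < r -> D (z - r) -> D (z + r) ->
  exists B, 0 <= B /\ forall h, Rabs h <= r -> Rabs (f (z + h) - f z) <= B * Rabs h.
Proof.
intros Hc Hr H1 H2.
destruct (concave_on_scaled D f (z - r) (z + r) z Hc H1 H2) as [Hz _]; [lra|].
pose (s1 := (f (z + r) - f z) / (z + r - z)).
pose (s2 := (f (z - r) - f z) / (z - r - z)).
exists (Rabs s1 + Rabs s2). split; [pose proof (Rabs_pos s1); pose proof (Rabs_pos s2); lra|].
intros h Hh.
destruct (Req_dec h 0) as [->|Hn].
{ rewrite Rplus_0_r, Rminus_diag, Rabs_R0. lra. }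
assert (Hs : s1 <= (f (z + h) - f z) / (z + h - z) <= s2).
{ apply Rabs_le_between in Hh. destruct (Rlt_or_le h 0) as [Hl|Hl].
  - destruct (concave_slope_left D f z (z + h) (z - r) Hc Hz H1) as [A B]; [lra|].
    split; [|easy]. apply concave_slope_between with D; auto; lra.
  - destruct (concave_slope_right D f z (z + h) (z + r) Hc Hz H2) as [A B]; [lra|].
    split; [easy|]. apply concave_slope_between with D; auto; lra. }
replace (f (z + h) - f z) with ((f (z + h) - f z) / (z + h - z) * h) by (field; lra).
rewrite Rabs_mult. apply Rmult_le_compat_r; [apply Rabs_pos|].
apply Rabs_le.
pose proof (Rle_abs s2). pose proof (Rle_abs (- s1)) as Q. rewrite Rabs_Ropp in Q.
pose proof (Rabs_pos s1); pose proof (Rabs_pos s2). lra.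
Qed.

Definition ek (Q : R -> Rbar) (t : R) : R := ebar (Q t).

Lemma ek_periodic Q : concave_kernel Q -> periodic (ek Q).
Proof. intros (H & _) t. unfold ek. now rewrite H. Qed.

Lemma Kr_periodic Q : concave_kernel Q -> periodic (Kr Q).
Proof. intros (H & _) t. unfold Kr. now rewrite H. Qed.

Lemma ek_exp Q t : 0 < ek Q t -> ek Q t = exp (Kr Q t).
Proof. intros H. now apply ebar_pos. Qed.

Lemma ek_open Q t : concave_kernel Q -> in_open t -> 0 < ek Q t.
Proof.
intros (_ & _ & H & _) Ht. unfold ek. rewrite <- (H t Ht). apply exp_pos.
Qed.

Lemma in_open_convex x y l : in_open x -> in_open y -> 0 <= l <= 1 -> in_open (l * x + (1 - l) * y).
Proof.
unfold in_open; intros Hx Hy Hl.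
destruct (Req_dec l 0) as [->|]; [lra|].
assert (0 < l * x) by (apply Rmult_lt_0_compat; lra).
assert (l * x < l * (2 * PI)) by (apply Rmult_lt_compat_l; lra).
assert (0 <= (1 - l) * y) by (apply Rmult_le_pos; lra).
assert ((1 - l) * y <= (1 - l) * (2 * PI)) by (apply Rmult_le_compat_l; lra).
lra.
Qed.

Lemma Kr_concave_open Q : concave_kernel Q -> concave_on in_open (Kr Q).
Proof.
intros (_ & _ & _ & H & _) x y l Hx Hy Hl. split; [now apply in_open_convex|auto].
Qed.

Lemma in_open_radius t : in_open t -> exists r, 0 < r /\ forall h, Rabs h <= r -> in_open (t + h).
Proof.
unfold in_open; intros Ht. exists (Rmin t (2 * PI - t) / 2).
pose proof (Rmin_l t (2 * PI - t)). pose proof (Rmin_r t (2 * PI - t)).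
assert (0 < Rmin t (2 * PI - t)) by (apply Rmin_glb_lt; lra).
split; [lra|]. intros h Hh. apply Rabs_le_between in Hh. lra.
Qed.

Lemma Kr_lipschitz_open Q t : concave_kernel Q -> in_open t ->
  exists B r, 0 < r /\ 0 <= B /\ (forall h, Rabs h <= r -> in_open (t + h)) /\
  forall h, Rabs h <= r -> Rabs (Kr Q (t + h) - Kr Q t) <= B * Rabs h.
Proof.
intros HQ Ht. destruct (in_open_radius t Ht) as (r & Hr & Hin).
destruct (concave_local_lipschitz in_open (Kr Q) t r) as (B & HB0 & HB); auto.
- now apply Kr_concave_open.
- replace (t - r) with (t + - r) by ring. apply Hin. rewrite Rabs_Ropp, Rabs_right; lra.
- apply Hin. rewrite Rabs_right; lra.
- exists B, r; auto.
Qed.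

Lemma continuous_sides (f : R -> R) x :
  filterlim f (at_left x) (locally (f x)) -> filterlim f (at_right x) (locally (f x)) -> continuous f x.
Proof.
intros H1 H2 P HP. specialize (H1 P HP). specialize (H2 P HP).
unfold filtermap, at_left, at_right, within in *.
generalize (filter_and _ _ H1 H2). apply filter_imp. intros y [A B].
destruct (Rtotal_order y x) as [H|[->|H]]; auto.
now apply locally_singleton.
Qed.

Lemma ebar_filterlim (g : R -> R) Fl (l : Rbar) : Filter Fl -> l <> p_infty ->
  filterlim g Fl (Rbar_locally l) -> filterlim (fun t => exp (g t)) Fl (locally (ebar l)).
Proof.
intros HF Hl Hg. destruct l as [l| |]; [| easy |].
- apply (filterlim_comp _ _ _ g exp _ (locally l)); [easy|].
  apply continuity_pt_filterlim. apply derivable_continuous_pt, derivable_pt_exp.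
- apply (filterlim_comp _ _ _ g exp _ (Rbar_locally m_infty)); [easy|].
  exact is_lim_exp_m.
Qed.

Lemma locally_lt (x b : R) : x < b -> locally x (fun y => y < b).
Proof. intros H. apply (open_lt b x H). Qed.

Lemma locally_gt (x b : R) : b < x -> locally x (fun y => b < y).
Proof. intros H. apply (open_gt b x H). Qed.

(** Inside the period this is concavity. At 0 the two one-sided limits agree with the value by the
    definition of a kernel, and a limit [-oo] becomes the ordinary limit 0. *)
Lemma ek_cont Q t : concave_kernel Q -> continuous (ek Q) t.
Proof.
intros HQ. pose proof two_PI_pos as HP.
assert (Hopen : forall t, in_open t -> continuous (ek Q) t).
{ clear t. intros t Ht.
  apply (continuous_ext_loc _ (fun x => exp (Kr Q x))).
  - destruct (in_open_radius t Ht) as (r & Hr & Hin). exists (mkposreal r Hr). intros y Hy.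
    symmetry; apply ek_exp, ek_open; auto. replace y with (t + (y - t)) by ring. apply Hin.
    left. apply Hy.
  - apply (continuous_comp (Kr Q) exp).
    2:{ apply continuity_pt_filterlim. apply derivable_continuous_pt, derivable_pt_exp. }
    destruct (Kr_lipschitz_open Q t HQ Ht) as (B & r & Hr & HB & _ & Hl).
    apply continuity_pt_filterlim. intros eps Heps.
    exists (Rmin r (eps / (B + 1))). split.
    + apply Rmin_glb_lt; [easy|]. apply Rdiv_lt_0_compat; lra.
    + intros y [_ Hy]. simpl in *. unfold Rdist in *.
      assert (H1 : Rabs (y - t) < r) by (eapply Rlt_le_trans; [apply Hy|apply Rmin_l]).
      assert (H2 : Rabs (y - t) < eps / (B + 1)) by (eapply Rlt_le_trans; [apply Hy|apply Rmin_r]).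
      apply Rlt_div_r in H2; [|lra].
      specialize (Hl (y - t)). replace (t + (y - t)) with y in Hl by ring.
      pose proof (Rabs_pos (y - t)). assert (Rabs (y - t) <= r) by lra. specialize (Hl H0). nra. }
assert (H0 : continuous (ek Q) 0).
{ pose proof HQ as (Hper & _ & _ & _ & l & Hl & Hr & Hle & H0).
  assert (E : ek Q 0 = ebar l) by (unfold ek; now rewrite H0).
  apply continuous_sides; rewrite E.
  - apply (filterlim_ext_loc (fun t => exp (Kr Q (t + 2 * PI)))).
    + unfold at_left, within. apply filter_imp with (fun y => - (2 * PI) < y).
      * intros y Hy Hy0. rewrite Kr_periodic by easy. symmetry; apply ek_exp.
        rewrite <- (ek_periodic Q HQ). apply ek_open; auto. unfold in_open; lra.
      * apply locally_gt; lra.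
    + apply ebar_filterlim; auto. typeclasses eauto.
      apply (filterlim_comp _ _ _ (fun t => t + 2 * PI) (Kr Q) _ (at_left (2 * PI))); [|easy].
      intros P [d Hd]. exists d. intros y Hy Hy0. apply Hd; [|lra].
      unfold ball in *; simpl in *; unfold AbsRing_ball, abs, minus, plus, opp in *; simpl in *.
      replace (y + 2 * PI + - (2 * PI)) with (y + - 0) by ring. easy.
  - apply (filterlim_ext_loc (fun t => exp (Kr Q t))).
    + unfold at_right, within. apply filter_imp with (fun y => y < 2 * PI).
      * intros y Hy Hy0. symmetry; apply ek_exp. apply ek_open; auto. unfold in_open; lra.
      * apply locally_lt; lra.
    + apply ebar_filterlim; auto. typeclasses eauto. }
destruct (periodic_reduce t) as (c & Hc & Hf).
apply (continuous_ext (fun x => ek Q (x + c))).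
{ intros x. apply (Hf R (ek Q)). now apply ek_periodic. }
apply (continuous_comp (fun x => x + c) (ek Q)).
- apply (continuous_plus (fun x => x) (fun _ => c)); [apply continuous_id|apply continuous_const].
- destruct (Req_dec (t + c) 0) as [->|]; [easy|]. apply Hopen. unfold in_open; lra.
Qed.

Lemma Kr_cont_pos Q t : concave_kernel Q -> 0 < ek Q t -> continuous (Kr Q) t.
Proof.
intros HQ Ht. apply (continuous_ext_loc _ (fun x => ln (ek Q x))).
- assert (H : locally t (fun y => 0 < ek Q y)).
  { apply (ek_cont Q t HQ). now apply locally_gt. }
  revert H. apply filter_imp. intros y Hy. rewrite ek_exp by easy. apply ln_exp.
- apply (continuous_comp (ek Q) ln); [now apply ek_cont|].
  apply continuity_pt_filterlim. apply derivable_continuous_pt.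
  exists (/ ek Q t). now apply derivable_pt_lim_ln.
Qed.

(** For a concave kernel this is the closed period or the open one, according to whether the common
    limit at the ends is finite. *)
Definition fin_dom (Q : R -> Rbar) (t : R) : Prop := 0 <= t <= 2 * PI /\ 0 < ek Q t.

Lemma fin_dom_open Q t : concave_kernel Q -> in_open t -> fin_dom Q t.
Proof. intros HQ Ht. split; [unfold in_open in Ht; lra|now apply ek_open]. Qed.

Lemma in_open_between x y l : 0 <= x <= 2 * PI -> 0 <= y <= 2 * PI -> x <> y -> 0 < l < 1 ->
  in_open (l * x + (1 - l) * y).
Proof.
intros Hx Hy Hn Hl. unfold in_open.
destruct (Rtotal_order x y) as [H|[H|H]]; [|easy|]; nra.
Qed.

Lemma Kr_concave_closed Q : concave_kernel Q -> concave_on (fin_dom Q) (Kr Q).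
Proof.
intros HQ x y l Hx Hy Hl. pose proof PI_RGT_0 as HP.
destruct (Req_dec x y) as [->|Hn].
{ replace (l * y + (1 - l) * y) with y by ring. split; [easy|right; ring]. }
destruct (Req_dec l 0) as [->|Hl0].
{ replace (0 * x + (1 - 0) * y) with y by ring. split; [easy|right; ring]. }
destruct (Req_dec l 1) as [->|Hl1].
{ replace (1 * x + (1 - 1) * y) with x by ring. split; [easy|right; ring]. }
assert (Hm : in_open (l * x + (1 - l) * y)).
{ apply in_open_between; try apply Hx; try apply Hy; auto; lra. }
split; [now apply fin_dom_open|].
(* Points are pulled into the open period by homotheties centred at [PI]; being affine, these
   commute with convex combinations, and the inequality passes to the limit. *)
assert (Hcv : forall u, 0 < ek Q u -> is_lim_seq (fun n => Kr Q (u + (PI - u) * / (INR n + 1))) (Kr Q u)).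
{ intros u Hu. apply is_lim_seq_continuous.
  - now apply continuity_pt_filterlim, Kr_cont_pos.
  - replace (Finite u) with (Rbar_plus u (Rbar_mult (PI - u) 0)).
    2:{ simpl. f_equal; ring. }
    apply is_lim_seq_plus'; [apply is_lim_seq_const|].
    apply (is_lim_seq_scal_l _ (PI - u) 0).
    replace (Finite 0) with (Rbar_inv p_infty) by reflexivity.
    apply is_lim_seq_inv; [|easy].
    eapply is_lim_seq_plus; [apply is_lim_seq_INR|apply is_lim_seq_const|easy]. }
apply (is_lim_seq_le (fun n => l * Kr Q (x + (PI - x) * / (INR n + 1)) + (1 - l) * Kr Q (y + (PI - y) * / (INR n + 1)))
  (fun n => Kr Q (l * x + (1 - l) * y + (PI - (l * x + (1 - l) * y)) * / (INR n + 1)))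
  (l * Kr Q x + (1 - l) * Kr Q y) (Kr Q (l * x + (1 - l) * y))).
- intros n. pose (e := / (INR n + 1)). fold e.
  assert (He : 0 < e <= 1).
  { pose proof (pos_INR n). unfold e. split; [apply Rinv_0_lt_compat; lra|].
    apply (Rmult_le_reg_l (INR n + 1)); [lra|]. rewrite Rinv_r; lra. }
  replace (l * x + (1 - l) * y + (PI - (l * x + (1 - l) * y)) * e) with
    (l * (x + (PI - x) * e) + (1 - l) * (y + (PI - y) * e)) by ring.
  assert (Hin : forall u, 0 <= u <= 2 * PI -> in_open (u + (PI - u) * e)) by (intros u Hu; unfold in_open; nra).
  apply Kr_concave_open; auto; apply Hin; [apply Hx|apply Hy].
- apply is_lim_seq_plus'; apply (is_lim_seq_scal_l _ _ (Finite _)); apply Hcv; [apply Hx|apply Hy].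
- apply Hcv. now apply ek_open.
Qed.

Lemma Kr_strict_closed Q x y l : strictly_concave_kernel Q -> fin_dom Q x -> fin_dom Q y ->
  x <> y -> 0 < l < 1 -> l * Kr Q x + (1 - l) * Kr Q y < Kr Q (l * x + (1 - l) * y).
Proof.
intros [HQ HS] Hx Hy Hn Hl.
set (m := l * x + (1 - l) * y).
assert (Hm : in_open m) by (apply in_open_between; try apply Hx; try apply Hy; auto).
assert (Hmf := fin_dom_open Q m HQ Hm).
(* Strictness is given in the open period only. The points [x'] and [y'] lie there and have the same
   combination [m]; plain concavity on the segments from [x] and from [y] to [m] carries the strict
   inequality outwards. *)
pose (x' := / 2 * x + (1 - / 2) * m). pose (y' := / 2 * y + (1 - / 2) * m).
assert (Hxm : x <> m). { unfold m; intros E. apply Hn. nra. }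
assert (Hym : y <> m). { unfold m; intros E. apply Hn. nra. }
destruct (Kr_concave_closed Q HQ x m (/ 2) Hx Hmf) as [_ A]; [lra|].
destruct (Kr_concave_closed Q HQ y m (/ 2) Hy Hmf) as [_ B]; [lra|].
assert (C : l * Kr Q x' + (1 - l) * Kr Q y' < Kr Q (l * x' + (1 - l) * y')).
{ apply HS; auto.
  - apply in_open_between; try apply Hx; try apply Hmf; auto; lra.
  - apply in_open_between; try apply Hy; try apply Hmf; auto; lra.
  - unfold x', y'; lra. }
replace (l * x' + (1 - l) * y') with m in C by (unfold x', y', m; field).
fold x' in A; fold y' in B. nra.
Qed.

(** * Sums of translates *)

Definition expF (L K : R -> Rbar) (n : nat) (y : nat -> R) (t : R) : R := ebar (F L K n y t).
(** Meaningful only where every term is finite, since [real] turns [-oo] into 0; it is therefore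
    compared with [expF] at points where [expF] is positive. *)
Definition Fr (L K : R -> Rbar) (n : nat) (y : nat -> R) (t : R) : R :=
  Kr L t + sm (fun i => Kr K (t - y i)) n.

Lemma kernel_not_p Q t : concave_kernel Q -> Q t <> p_infty.
Proof. intros (_ & H & _). apply H. Qed.

Lemma sumK_not_p K y t n : concave_kernel K -> sumK K y t n <> p_infty.
Proof.
intros HK; induction n as [|n IH]; simpl; [easy|].
apply ebar_plus; [easy|now apply kernel_not_p].
Qed.

Lemma ebar_sumK_S K y t n : concave_kernel K ->
  ebar (sumK K y t (S n)) = ebar (sumK K y t n) * ek K (t - y (S n)).
Proof. intros HK. simpl. apply ebar_plus; [now apply sumK_not_p|now apply kernel_not_p]. Qed.

Lemma F_not_p L K n y t : concave_kernel L -> concave_kernel K -> F L K n y t <> p_infty.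
Proof. intros HL HK. apply ebar_plus; [now apply kernel_not_p|now apply sumK_not_p]. Qed.

Lemma expF_eq L K n y t : concave_kernel L -> concave_kernel K ->
  expF L K n y t = ek L t * ebar (sumK K y t n).
Proof. intros HL HK. apply ebar_plus; [now apply kernel_not_p|now apply sumK_not_p]. Qed.

Lemma expF_ge0 L K n y t : 0 <= expF L K n y t.
Proof. apply ebar_ge0. Qed.

Lemma Rmult_pos_inv a b : 0 <= a -> 0 <= b -> 0 < a * b -> 0 < a /\ 0 < b.
Proof. intros Ha Hb H. split; apply Rnot_le_lt; intros N; nra. Qed.

Lemma expF_pos_exp L K n y t : concave_kernel L -> concave_kernel K -> 0 < ek L t ->
  (forall i, (1 <= i <= n)%nat -> 0 < ek K (t - y i)) -> expF L K n y t = exp (Fr L K n y t).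
Proof.
intros HL HK H0 H. rewrite expF_eq by easy. unfold Fr. rewrite exp_plus.
rewrite (ek_exp L) by easy. f_equal.
induction n as [|n IH]; [reflexivity|].
rewrite ebar_sumK_S by easy. simpl sm. rewrite exp_plus, IH by (intros; apply H; lia).
f_equal. apply ek_exp. apply H; lia.
Qed.

Lemma expF_pos_inv L K n y t : concave_kernel L -> concave_kernel K -> 0 < expF L K n y t ->
  0 < ek L t /\ forall i, (1 <= i <= n)%nat -> 0 < ek K (t - y i).
Proof.
intros HL HK. rewrite expF_eq by easy. intros H.
destruct (Rmult_pos_inv (ek L t) (ebar (sumK K y t n))) as [H1 H2]; try apply ebar_ge0; auto.
split; [easy|]. clear H H1. induction n as [|n IH]; [intros; lia|].
rewrite ebar_sumK_S in H2 by easy.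
apply Rmult_pos_inv in H2; try apply ebar_ge0. destruct H2 as [H2 H3].
intros i Hi. destruct (Nat.eq_dec i (S n)) as [->|]; [easy|apply IH; auto; lia].
Qed.

Lemma expF_ext L K n y y' t : (forall i, (1 <= i <= n)%nat -> y i = y' i) ->
  expF L K n y t = expF L K n y' t.
Proof.
intros H. unfold expF, F. f_equal. f_equal.
induction n as [|n IH]; simpl; [easy|].
rewrite IH by (intros; apply H; lia). rewrite H by lia. reflexivity.
Qed.

Lemma expF_periodic L K n y : concave_kernel L -> concave_kernel K -> periodic (expF L K n y).
Proof.
intros HL HK t. rewrite !expF_eq by easy. f_equal; [now apply ek_periodic|].
induction n as [|n IH]; [reflexivity|]. rewrite !ebar_sumK_S by easy. rewrite IH. f_equal.
replace (t + 2 * PI - y (S n)) with (t - y (S n) + 2 * PI) by ring. now apply ek_periodic.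
Qed.

Lemma expF_reduce_t L K n y t : concave_kernel L -> concave_kernel K ->
  exists t', 0 <= t' < 2 * PI /\ expF L K n y t' = expF L K n y t.
Proof.
intros HL HK. destruct (periodic_reduce t) as (c & Hc & Hf).
exists (t + c); split; [easy|]. apply (Hf R (expF L K n y)). now apply expF_periodic.
Qed.

Lemma expF_reduce_y L K n y : concave_kernel L -> concave_kernel K ->
  exists y', inT n y' /\ forall t, expF L K n y' t = expF L K n y t.
Proof.
intros HL HK.
destruct (choice (fun i c => 0 <= y i + c < 2 * PI /\
  forall (A : Type) (f : R -> A), periodic f -> forall t, f (t + c) = f t)) as [c Hc].
{ intros i; apply periodic_reduce. }
exists (fun i => y i + c i). split; [intros i Hi; apply Hc|].
intros t. rewrite !expF_eq by easy. f_equal.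
induction n as [|n IH]; [reflexivity|]. rewrite !ebar_sumK_S by easy. rewrite IH. f_equal.
destruct (Hc (S n)) as [_ H]. rewrite <- (H _ _ (ek_periodic K HK) (t - (y (S n) + c (S n)))).
f_equal; ring.
Qed.

Lemma expF_cont L K n y t : concave_kernel L -> concave_kernel K -> continuous (expF L K n y) t.
Proof.
intros HL HK. apply (continuous_ext (fun t => ek L t * ebar (sumK K y t n))).
{ intros x; symmetry; now apply expF_eq. }
apply (continuous_mult (ek L) (fun t => ebar (sumK K y t n))); [now apply ek_cont|].
induction n as [|n IH]; [apply continuous_const|].
apply (continuous_ext (fun t => ebar (sumK K y t n) * ek K (t - y (S n)))).
{ intros x; symmetry; now apply ebar_sumK_S. }
apply (continuous_mult (fun t => ebar (sumK K y t n)) (fun t => ek K (t - y (S n)))); [easy|].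
apply (continuous_comp (fun t => t - y (S n)) (ek K)); [|now apply ek_cont].
apply (continuous_minus (fun t : R => t) (fun _ => y (S n))); [apply continuous_id|apply continuous_const].
Qed.

Lemma expF_lim_seq L K n (y : nat -> nat -> R) (w : nat -> R) (t : nat -> R) (t0 : R) :
  concave_kernel L -> concave_kernel K ->
  (forall i, (1 <= i <= n)%nat -> is_lim_seq (fun k => y k i) (w i)) -> is_lim_seq t t0 ->
  is_lim_seq (fun k => expF L K n (y k) (t k)) (expF L K n w t0).
Proof.
intros HL HK Hy Ht.
apply (is_lim_seq_ext (fun k => ek L (t k) * ebar (sumK K (y k) (t k) n))).
{ intros k; symmetry; now apply expF_eq. }
rewrite expF_eq by easy.
apply is_lim_seq_mult'.
{ apply is_lim_seq_continuous; [|easy]. now apply continuity_pt_filterlim, ek_cont. }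
induction n as [|n IH]; [apply is_lim_seq_const|].
apply (is_lim_seq_ext (fun k => ebar (sumK K (y k) (t k) n) * ek K (t k - y k (S n)))).
{ intros k; symmetry; now apply ebar_sumK_S. }
rewrite ebar_sumK_S by easy.
apply is_lim_seq_mult'; [apply IH; intros; apply Hy; lia|].
apply is_lim_seq_continuous; [now apply continuity_pt_filterlim, ek_cont|].
apply is_lim_seq_minus'; [easy|apply Hy; lia].
Qed.

Lemma expF_max L K n y a b : concave_kernel L -> concave_kernel K -> a <= b ->
  exists z, a <= z <= b /\ forall t, a <= t <= b -> expF L K n y t <= expF L K n y z.
Proof.
intros HL HK Hab.
destruct (continuity_ab_maj (expF L K n y) a b Hab) as (z & H1 & H2).
- intros c _. now apply continuity_pt_filterlim, expF_cont.
- exists z; auto.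
Qed.

Lemma expF_max_glob L K n y : concave_kernel L -> concave_kernel K ->
  exists z, 0 <= z < 2 * PI /\ forall t, expF L K n y t <= expF L K n y z.
Proof.
intros HL HK. pose proof two_PI_pos.
destruct (expF_max L K n y 0 (2 * PI) HL HK) as (z & _ & Hz); [lra|].
destruct (expF_reduce_t L K n y z HL HK) as (z' & Hz' & E).
exists z'; split; [easy|]. intros t.
destruct (expF_reduce_t L K n y t HL HK) as (t' & Ht' & E').
rewrite E, <- E'. apply Hz; lra.
Qed.

(* [arc_shift j i] brings [t - y i] back to [[0, 2 PI]] when [t] lies between the
   [j]-th and the [(j+1)]-st node of a sorted [y]. *)
Definition arc_shift (j i : nat) : R := if (i <=? j)%nat then 0 else 2 * PI.
(** The constraints are affine in [(y, t)], hence stable under convex combinations, and they also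
    make sense when [y] is unsorted or leaves the period. *)
Definition in_arc (n j : nat) (y : nat -> R) (t : R) : Prop :=
  0 <= t <= 2 * PI /\ forall i, (1 <= i <= n)%nat -> 0 <= t - y i + arc_shift j i <= 2 * PI.

Lemma periodic_shift {A : Type} (f : R -> A) j i t : periodic f -> f (t + arc_shift j i) = f t.
Proof. intros Hf. unfold arc_shift. destruct (i <=? j)%nat; [now rewrite Rplus_0_r|apply Hf]. Qed.

(** The common shifts bring both sets of kernel arguments into the closed period, where they combine
    affinely and concavity applies term by term. Strictness comes from [L] if [t1 <> t2], and
    otherwise from a translate whose node differs. On the exponential scale concavity takes the form
    of a comparison with a common level [m]. *)
Lemma expF_arc_concave L K n j x y t1 t2 l m :
  strictly_concave_kernel L -> strictly_concave_kernel K ->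
  in_arc n j x t1 -> in_arc n j y t2 -> 0 < l < 1 -> 0 < m ->
  m <= expF L K n x t1 -> m <= expF L K n y t2 ->
  (exists i, (1 <= i <= n)%nat /\ x i <> y i) ->
  m < expF L K n (fun i => l * x i + (1 - l) * y i) (l * t1 + (1 - l) * t2).
Proof.
intros SL SK [Ht1 Hx] [Ht2 Hy] Hl Hm Hm1 Hm2 (k & Hk & Hne).
pose proof SL as [HL _]. pose proof SK as [HK _].
destruct (expF_pos_inv L K n x t1) as [P1 P1']; auto; [lra|].
destruct (expF_pos_inv L K n y t2) as [P2 P2']; auto; [lra|].
assert (D1 : fin_dom L t1) by (split; auto). assert (D2 : fin_dom L t2) by (split; auto).
destruct (Kr_concave_closed L HL t1 t2 l D1 D2) as [[_ P3] C3]; [lra|].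
assert (DK : forall i, (1 <= i <= n)%nat ->
  fin_dom K (t1 - x i + arc_shift j i) /\ fin_dom K (t2 - y i + arc_shift j i)).
{ intros i Hi. split; (split; [auto|]); rewrite (periodic_shift (ek K)); auto using ek_periodic. }
assert (E : forall i, l * t1 + (1 - l) * t2 - (l * x i + (1 - l) * y i) + arc_shift j i
  = l * (t1 - x i + arc_shift j i) + (1 - l) * (t2 - y i + arc_shift j i)) by (intros i; ring).
assert (Es : forall (A : Type) (f : R -> A), periodic f -> forall u i, f u = f (u + arc_shift j i)).
{ intros A f Hf u i. symmetry. now apply periodic_shift. }
assert (PK : forall i, (1 <= i <= n)%nat ->
  0 < ek K (l * t1 + (1 - l) * t2 - (l * x i + (1 - l) * y i)) /\
  l * Kr K (t1 - x i) + (1 - l) * Kr K (t2 - y i) <= Kr K (l * t1 + (1 - l) * t2 - (l * x i + (1 - l) * y i))).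
{ intros i Hi. destruct (DK i Hi) as [A B].
  rewrite (Es _ _ (ek_periodic K HK) _ i), (Es _ _ (Kr_periodic K HK) (t1 - x i) i),
    (Es _ _ (Kr_periodic K HK) (t2 - y i) i), (Es _ _ (Kr_periodic K HK) (l * t1 + _ - _) i).
  rewrite E. destruct (Kr_concave_closed K HK _ _ l A B) as [[_ Q1] Q2]; [lra|]. easy. }
rewrite expF_pos_exp in Hm1, Hm2 |- *; auto.
2:{ intros i Hi; now apply PK. }
rewrite <- (exp_ln m Hm) in *.
assert (H1 : ln m <= Fr L K n x t1) by (destruct Hm1 as [H|H]; [left; now apply exp_lt_inv|right; now apply exp_inv]).
assert (H2 : ln m <= Fr L K n y t2) by (destruct Hm2 as [H|H]; [left; now apply exp_lt_inv|right; now apply exp_inv]).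
apply exp_increasing.
assert (H : l * Fr L K n x t1 + (1 - l) * Fr L K n y t2
   < Fr L K n (fun i => l * x i + (1 - l) * y i) (l * t1 + (1 - l) * t2)); [|nra].
unfold Fr.
assert (E2 := sm_lin l (1 - l) (fun i => Kr K (t1 - x i)) (fun i => Kr K (t2 - y i)) n).
destruct (Req_dec t1 t2) as [Et|Nt].
- assert (sm (fun i => l * Kr K (t1 - x i) + (1 - l) * Kr K (t2 - y i)) n <
    sm (fun i => Kr K (l * t1 + (1 - l) * t2 - (l * x i + (1 - l) * y i))) n); [|lra].
  apply sm_lt with k; auto.
  + intros i Hi; now apply PK.
  + rewrite (Es _ _ (Kr_periodic K HK) (t1 - x k) k),
      (Es _ _ (Kr_periodic K HK) (t2 - y k) k), (Es _ _ (Kr_periodic K HK) (l * t1 + _ - _) k).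
    rewrite E. destruct (DK k Hk). apply Kr_strict_closed; auto. lra.
- assert (l * Kr L t1 + (1 - l) * Kr L t2 < Kr L (l * t1 + (1 - l) * t2)) by (apply Kr_strict_closed; auto).
  assert (sm (fun i => l * Kr K (t1 - x i) + (1 - l) * Kr K (t2 - y i)) n <=
    sm (fun i => Kr K (l * t1 + (1 - l) * t2 - (l * x i + (1 - l) * y i))) n); [|lra].
  apply sm_le. intros i Hi; now apply PK.
Qed.

Lemma concave_on_shift (D : R -> Prop) f c : concave_on D f ->
  concave_on (fun t => D (t + c)) (fun t => f (t + c)).
Proof.
intros H x y l Hx Hy Hl.
replace (l * x + (1 - l) * y + c) with (l * (x + c) + (1 - l) * (y + c)) by ring. now apply H.
Qed.

(** Each translate satisfies [K (t - y i) <= K (z - w i) + k i * ((t - z) - (y i - w i))], and [L]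
    contributes [- sm k n * (t - z)]. The terms in [t] cancel, which leaves a bound in the node
    displacements alone: [- k] is a supergradient at [w] of the logarithmic arc maximum. *)
Lemma arc_supergradient L K n j w z m :
  concave_kernel L -> concave_kernel K -> 0 < m ->
  0 <= z <= 2 * PI -> (forall i, (1 <= i <= n)%nat -> 0 < z - w i + arc_shift j i < 2 * PI) ->
  expF L K n w z = m -> (forall t, expF L K n w t <= m) ->
  exists k : nat -> R, forall y t, in_arc n j y t -> 0 < expF L K n y t ->
    expF L K n y t <= m * exp (- sm (fun i => k i * (y i - w i)) n).
Proof.
intros HL HK Hm Hz Hzi Ez Hmax.
destruct (expF_pos_inv L K n w z) as [P1 P1']; auto; [lra|].
destruct (concave_separation_sum
  (fun i t => fin_dom K (t + (- w i + arc_shift j i))) (fun i t => Kr K (t + (- w i + arc_shift j i)))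
  (fin_dom L) z n (Kr L)) as (k & Hk1 & Hk2).
- now apply Kr_concave_closed.
- intros i Hi. apply concave_on_shift, (Kr_concave_closed K HK).
- now split.
- intros i Hi. specialize (Hzi i Hi).
  assert (Hin : in_open (z + (- w i + arc_shift j i))) by (unfold in_open; lra).
  split; [now apply fin_dom_open|].
  destruct (in_open_radius _ Hin) as (r & Hr & H).
  exists (z - r), (z + r). split; [lra|]. split; apply fin_dom_open; auto.
  + replace (z - r + (- w i + arc_shift j i)) with (z + (- w i + arc_shift j i) + - r) by ring.
    apply H. rewrite Rabs_Ropp, Rabs_right; lra.
  + replace (z + r + (- w i + arc_shift j i)) with (z + (- w i + arc_shift j i) + r) by ring.
    apply H. rewrite Rabs_right; lra.
- intros t Ht Hti. specialize (Hmax t). rewrite <- Ez in Hmax.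
  assert (Es : forall t, sm (fun i => Kr K (t + (- w i + arc_shift j i))) n = sm (fun i => Kr K (t - w i)) n).
  { intros u. apply sm_ext. intros i Hi. rewrite <- Rplus_assoc. now apply (periodic_shift (Kr K)), Kr_periodic. }
  rewrite !Es.
  rewrite !expF_pos_exp in Hmax; auto; [|apply Ht|].
  + change (Fr L K n w t <= Fr L K n w z).
    destruct Hmax as [H|H]; [left; now apply exp_lt_inv|right; now apply exp_inv].
  + intros i Hi. destruct (Hti i Hi) as [_ H]. rewrite <- Rplus_assoc, (periodic_shift (ek K)) in H; auto using ek_periodic.
- exists k. intros y t [Ht Hyt] Hpos.
  destruct (expF_pos_inv L K n y t) as [P2 P2']; auto.
  rewrite <- Ez, !expF_pos_exp, <- exp_plus; auto.
  assert (H : Fr L K n y t <= Fr L K n w z + - sm (fun i => k i * (y i - w i)) n).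
  2:{ destruct H as [H|H]; [left; now apply exp_increasing|right; now rewrite H]. }
  unfold Fr.
  assert (A : Kr L t <= Kr L z - sm k n * (t - z)) by (apply Hk2; split; auto).
  assert (B : sm (fun i => Kr K (t - y i)) n <=
     sm (fun i => 1 * (1 * Kr K (z - w i) + (t - z) * k i) + (-1) * (k i * (y i - w i))) n).
  { apply sm_le. intros i Hi.
    specialize (Hk1 i (t - (y i - w i)) Hi). cbv beta in Hk1.
    replace (t - (y i - w i) + (- w i + arc_shift j i)) with (t - y i + arc_shift j i) in Hk1 by ring.
    replace (z + (- w i + arc_shift j i)) with (z - w i + arc_shift j i) in Hk1 by ring.
    rewrite !(periodic_shift (Kr K)) in Hk1 by now apply Kr_periodic.
    assert (fin_dom K (t - y i + arc_shift j i)).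
    { split; [auto|]. rewrite (periodic_shift (ek K)); auto using ek_periodic. }
    specialize (Hk1 H). lra. }
  rewrite sm_lin, sm_lin in B. lra.
Qed.

(** * Kinks at the nodes *)

(** A bound on increments instead of a derivative: it adds up over terms, and an infinite slope is
    expressed by having it for every [b]. *)
Definition lower_slope (f : R -> R) (b : R) : Prop :=
  exists r, 0 < r /\ forall h, 0 < h < r -> b * h <= f h.

Lemma lower_slope_add f g a b : lower_slope f a -> lower_slope g b ->
  lower_slope (fun h => f h + g h) (a + b).
Proof.
intros (r1 & H1 & A) (r2 & H2 & B). exists (Rmin r1 r2). split; [now apply Rmin_glb_lt|].
intros h Hh. pose proof (Rmin_l r1 r2); pose proof (Rmin_r r1 r2).
assert (a * h <= f h) by (apply A; lra). assert (b * h <= g h) by (apply B; lra). lra.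
Qed.

Lemma lower_slope_sm (f : nat -> R -> R) b n :
  (forall i, (1 <= i <= n)%nat -> lower_slope (f i) (b i)) ->
  lower_slope (fun h => sm (fun i => f i h) n) (sm b n).
Proof.
induction n as [|n IH]; intros H.
- exists 1. split; [lra|]. intros; simpl; lra.
- apply (lower_slope_add (fun h => sm (fun i => f i h) n) (f (S n))); [apply IH; intros|]; apply H; lia.
Qed.

Lemma sm_split f n k : (1 <= k <= n)%nat ->
  sm f n = f k + sm (fun i => if Nat.eqb i k then 0 else f i) n.
Proof.
induction n as [|n IH]; intros Hk; [lia|].
change (sm f n + f (S n) = f k + (sm (fun i => if Nat.eqb i k then 0 else f i) n +
  (if Nat.eqb (S n) k then 0 else f (S n)))).
destruct (Nat.eq_dec k (S n)) as [->|E].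
- rewrite Nat.eqb_refl. rewrite (sm_ext (fun i => if Nat.eqb i (S n) then 0 else f i) f); [ring|].
  intros i Hi. destruct (Nat.eqb_spec i (S n)); [lia|easy].
- rewrite IH by lia. destruct (Nat.eqb_spec (S n) k); [lia|]. ring.
Qed.

(** The values at 0 and [2 * PI] agree, so strict concavity makes the value at [PI] larger. The
    graph lies above the chords from both ends to the point over [PI], and [s] is their slope up to
    sign. *)
Lemma kernel_kink Q : strictly_concave_kernel Q -> 0 < ek Q 0 ->
  exists s, 0 < s /\ forall h, Rabs h <= PI -> Kr Q 0 + s * Rabs h <= Kr Q h.
Proof.
intros SQ H0. pose proof SQ as [HQ _]. pose proof PI_RGT_0 as HP.
assert (E2 : Kr Q (2 * PI) = Kr Q 0) by (rewrite <- (Kr_periodic Q HQ 0); f_equal; ring).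
assert (D0 : fin_dom Q 0) by (split; [lra|easy]).
assert (D2 : fin_dom Q (2 * PI)).
{ split; [lra|]. rewrite <- (Rplus_0_l (2 * PI)). now rewrite (ek_periodic Q HQ). }
assert (DP : fin_dom Q PI) by (apply fin_dom_open; auto; unfold in_open; lra).
assert (Hs : Kr Q 0 < Kr Q PI).
{ assert (A : / 2 * Kr Q 0 + (1 - / 2) * Kr Q (2 * PI) < Kr Q (/ 2 * 0 + (1 - / 2) * (2 * PI)))
    by (apply Kr_strict_closed; auto; lra).
  replace (/ 2 * 0 + (1 - / 2) * (2 * PI)) with PI in A by field. lra. }
exists ((Kr Q PI - Kr Q 0) / PI). split; [apply Rdiv_lt_0_compat; lra|].
intros h Hh. destruct (Rtotal_order h 0) as [H|[->|H]].
- rewrite Rabs_left in * by easy.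
  destruct (concave_slope_left (fin_dom Q) (Kr Q) (2 * PI) (h + 2 * PI) PI) as [_ A]; auto.
  { now apply Kr_concave_closed. } { lra. }
  rewrite Kr_periodic, E2 in A by easy.
  replace ((Kr Q h - Kr Q 0) / (h + 2 * PI - 2 * PI)) with (- ((Kr Q h - Kr Q 0) / (- h))) in A by (field; lra).
  replace ((Kr Q PI - Kr Q 0) / (PI - 2 * PI)) with (- ((Kr Q PI - Kr Q 0) / PI)) in A by (field; lra).
  apply Ropp_le_cancel, Rle_div_r in A; lra.
- rewrite Rabs_R0. lra.
- rewrite Rabs_right in * by lra.
  destruct (concave_slope_right (fin_dom Q) (Kr Q) 0 h PI) as [_ A]; auto.
  { now apply Kr_concave_closed. }
  rewrite !Rminus_0_r in A. apply Rle_div_r in A; lra.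
Qed.

(** The estimate is one-sided because a kernel may rise with infinite slope from its node. There the
    kink allows [B = 0]; elsewhere concavity gives a Lipschitz constant. *)
Lemma kernel_lower_lipschitz Q u : strictly_concave_kernel Q -> 0 < ek Q u ->
  exists B r, 0 < r /\ forall h, Rabs h <= r -> Kr Q u - B * Rabs h <= Kr Q (u + h).
Proof.
intros SQ Hu. pose proof SQ as [HQ _]. pose proof PI_RGT_0 as HP.
destruct (periodic_reduce u) as (c & Hc & Hf).
assert (E : forall h, Kr Q (u + h) = Kr Q (u + c + h)).
{ intros h. rewrite <- (Hf _ _ (Kr_periodic Q HQ) (u + h)). f_equal; ring. }
assert (E' : Kr Q u = Kr Q (u + c)) by (symmetry; apply (Hf _ _ (Kr_periodic Q HQ))).
rewrite <- (Hf _ _ (ek_periodic Q HQ) u) in Hu.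
destruct (Req_dec (u + c) 0) as [E0|N0].
- rewrite E0 in Hu. destruct (kernel_kink Q SQ Hu) as (s & Hs & H).
  exists 0, PI. split; [easy|]. intros h Hh. rewrite E, E', E0, Rplus_0_l.
  specialize (H h Hh). pose proof (Rabs_pos h). nra.
- destruct (Kr_lipschitz_open Q (u + c) HQ) as (B & r & Hr & HB & _ & H); [unfold in_open; lra|].
  exists B, r. split; [easy|]. intros h Hh. rewrite E, E'.
  specialize (H h Hh). apply Rabs_le_between in H. lra.
Qed.

(** Where the kernel is differentiable the symmetric second difference is [o(h)]; at its node the
    kink makes it nonnegative. *)
Lemma kernel_second_difference Q u eps : strictly_concave_kernel Q -> C1_open Q -> 0 < ek Q u -> 0 < eps ->
  lower_slope (fun h => (Kr Q (u + h) - Kr Q u) + (Kr Q (u - h) - Kr Q u)) (- eps).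
Proof.
intros SQ (dQ & HC) Hu He. pose proof SQ as [HQ _]. pose proof PI_RGT_0 as HP.
destruct (periodic_reduce u) as (c & Hc & Hf).
assert (E : forall h, Kr Q (u + h) = Kr Q (u + c + h)).
{ intros h. rewrite <- (Hf _ _ (Kr_periodic Q HQ) (u + h)). f_equal; ring. }
assert (E' : Kr Q u = Kr Q (u + c)) by (symmetry; apply (Hf _ _ (Kr_periodic Q HQ))).
rewrite <- (Hf _ _ (ek_periodic Q HQ) u) in Hu.
destruct (Req_dec (u + c) 0) as [E0|N0].
- rewrite E0 in *. destruct (kernel_kink Q SQ Hu) as (s & Hs & H).
  exists PI. split; [easy|]. intros h Hh. replace (u - h) with (u + - h) by ring. rewrite !E, E', !Rplus_0_l.
  pose proof (H h) as H1. pose proof (H (- h)) as H2. rewrite Rabs_Ropp in H2. rewrite (Rabs_right h) in H1, H2 by lra.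
  specialize (H1 ltac:(lra)). specialize (H2 ltac:(lra)). nra.
- destruct (HC (u + c)) as [Hd _]; [unfold in_open; lra|].
  apply is_derive_Reals in Hd. destruct (Hd (eps / 2)) as [d Hd']; [lra|].
  exists d. split; [apply cond_pos|]. intros h Hh. replace (u - h) with (u + - h) by ring. rewrite !E, E'.
  pose proof (Hd' h) as H1. pose proof (Hd' (- h)) as H2.
  rewrite Rabs_Ropp in H2. rewrite (Rabs_right h) in H1, H2 by lra.
  specialize (H1 ltac:(lra) ltac:(lra)). specialize (H2 ltac:(lra) ltac:(lra)).
  apply Rabs_def2 in H1, H2.
  replace ((Kr Q (u + c + - h) - Kr Q (u + c)) / - h) with (- (Kr Q (u + c + - h) - Kr Q (u + c)) / h) in H2 by (field; lra).
  assert (A : - (eps / 2) + dQ (u + c) < (Kr Q (u + c + h) - Kr Q (u + c)) / h) by lra.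
  assert (B : - (Kr Q (u + c + - h) - Kr Q (u + c)) / h < eps / 2 + dQ (u + c)) by lra.
  apply Rlt_div_r in A; [|lra]. apply Rlt_div_l in B; [|lra]. lra.
Qed.

(** The sign [s] records on which side of the node the slope is infinite. The chord from a nearby
    point to the node is at least as steep as a difference quotient taken at that point away from
    the node, and this quotient is close to a one-sided derivative already beyond the bound. *)
Lemma cond_infty'_slope K : concave_kernel K -> cond_infty' K -> 0 < ek K 0 ->
  exists s, (s = 1 \/ s = -1) /\ forall A, lower_slope (fun h => Kr K (s * h) - Kr K 0) A.
Proof.
intros HK HC H0. pose proof PI_RGT_0 as HP.
assert (E2 : Kr K (2 * PI) = Kr K 0) by (rewrite <- (Kr_periodic K HK 0); f_equal; ring).
assert (D0 : fin_dom K 0) by (split; [lra|easy]).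
assert (D2 : fin_dom K (2 * PI)).
{ split; [lra|]. rewrite <- (Rplus_0_l (2 * PI)). now rewrite (ek_periodic K HK). }
pose proof (Kr_concave_closed K HK) as Hc.
destruct HC as [(dm & dp & Hd & Hm & _)|(dm & dp & Hd & _ & Hp)].
- exists (-1). split; [now right|]. intros A.
  destruct (Hm (fun x => x < - A)) as [r Hr]; [now exists (- A)|].
  exists (Rmin r PI). split; [apply Rmin_glb_lt; [apply cond_pos|easy]|].
  intros h Hh. pose proof (Rmin_l r PI); pose proof (Rmin_r r PI).
  pose (t := 2 * PI - h). assert (Ht : in_open t) by (unfold in_open, t; lra).
  assert (Hdm : dm t < - A).
  { apply Hr; [|unfold t; lra]. unfold ball; simpl; unfold AbsRing_ball, abs, minus, plus, opp; simpl.
    replace (t + - (2 * PI)) with (- h) by (unfold t; ring). rewrite Rabs_Ropp, Rabs_right; lra. }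
  replace (-1 * h) with (- h) by ring.
  replace (Kr K (- h)) with (Kr K t). 2:{ rewrite <- (Kr_periodic K HK (- h)); f_equal; unfold t; ring. }
  apply Rnot_lt_le. intros Hlt.
  destruct (proj1 (Hd t Ht) (fun x => x < - A)) as [r' Hr']; [now apply locally_lt|].
  pose (k := - Rmin (r' / 2) (t / 2)).
  assert (Hk : - t < k < 0 /\ - r' < k).
  { unfold k. pose proof (Rmin_l (r' / 2) (t / 2)); pose proof (Rmin_r (r' / 2) (t / 2)).
    assert (0 < Rmin (r' / 2) (t / 2)) by (apply Rmin_glb_lt; [pose proof (cond_pos r'); lra|unfold in_open in Ht; lra]).
    pose proof (cond_pos r'). unfold in_open in Ht; lra. }
  assert (HA : (Kr K (t + k) - Kr K t) / k < - A).
  { apply Hr'; [|lra]. unfold ball; simpl; unfold AbsRing_ball, abs, minus, plus, opp; simpl.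
    replace (k + - 0) with k by ring. rewrite Rabs_left; lra. }
  assert (Dk : fin_dom K (t + k)) by (apply fin_dom_open; auto; unfold in_open in *; lra).
  pose proof (concave_slope_between (fin_dom K) (Kr K) t (t + k) (2 * PI) Hc Dk D2) as B.
  unfold in_open in Ht. specialize (B ltac:(lra)).
  replace (t + k - t) with k in B by ring.
  assert (C : (Kr K (2 * PI) - Kr K t) / (2 * PI - t) < - A) by lra.
  apply Rlt_div_l in C; [|lra]. replace (2 * PI - t) with h in C by (unfold t; ring). lra.
- exists 1. split; [now left|]. intros A.
  destruct (Hp (fun x => A < x)) as [r Hr]; [now exists A|].
  exists (Rmin r PI). split; [apply Rmin_glb_lt; [apply cond_pos|easy]|].
  intros h Hh. pose proof (Rmin_l r PI); pose proof (Rmin_r r PI).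
  assert (Ht : in_open h) by (unfold in_open; lra).
  assert (Hdp : A < dp h).
  { apply Hr; [|lra]. unfold ball; simpl; unfold AbsRing_ball, abs, minus, plus, opp; simpl.
    replace (h + - 0) with h by ring. rewrite Rabs_right; lra. }
  rewrite Rmult_1_l. apply Rnot_lt_le. intros Hlt.
  destruct (proj2 (Hd h Ht) (fun x => A < x)) as [r' Hr']; [now apply locally_gt|].
  pose (k := Rmin (r' / 2) PI).
  assert (Hk : 0 < k <= PI /\ k < r').
  { unfold k. pose proof (Rmin_l (r' / 2) PI); pose proof (Rmin_r (r' / 2) PI). pose proof (cond_pos r').
    assert (0 < Rmin (r' / 2) PI) by (apply Rmin_glb_lt; lra). lra. }
  assert (HA : A < (Kr K (h + k) - Kr K h) / k).
  { apply Hr'; [|lra]. unfold ball; simpl; unfold AbsRing_ball, abs, minus, plus, opp; simpl.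
    replace (k + - 0) with k by ring. rewrite Rabs_right; lra. }
  assert (Dk : fin_dom K (h + k)) by (apply fin_dom_open; auto; unfold in_open in *; lra).
  pose proof (concave_slope_between (fin_dom K) (Kr K) h 0 (h + k) Hc D0 Dk) as B.
  specialize (B ltac:(lra)). replace (h + k - h) with k in B by ring.
  replace ((Kr K 0 - Kr K h) / (0 - h)) with ((Kr K h - Kr K 0) / h) in B by (field; lra).
  assert (C : A < (Kr K h - Kr K 0) / h) by lra.
  apply Rlt_div_r in C; lra.
Qed.

Lemma expF_locally_pos L K n y t : concave_kernel L -> concave_kernel K -> 0 < expF L K n y t ->
  exists r, 0 < r /\ forall h, Rabs h < r -> 0 < expF L K n y (t + h).
Proof.
intros HL HK Ht. destruct (expF_cont L K n y t HL HK (fun x => 0 < x)) as [r Hr]; [now apply locally_gt|].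
exists r. split; [apply cond_pos|]. intros h Hh. apply Hr.
unfold ball; simpl; unfold AbsRing_ball, abs, minus, plus, opp; simpl.
now replace (t + h + - t) with h by ring.
Qed.

Lemma expF_lt_Fr L K n y t t' : concave_kernel L -> concave_kernel K ->
  0 < expF L K n y t -> 0 < expF L K n y t' -> Fr L K n y t < Fr L K n y t' ->
  expF L K n y t < expF L K n y t'.
Proof.
intros HL HK H H' Hlt. destruct (expF_pos_inv L K n y t HL HK H), (expF_pos_inv L K n y t' HL HK H').
rewrite !expF_pos_exp; auto. now apply exp_increasing.
Qed.

(* The kernel [K] has a downward kink at its node, which either dominates every other slope
   (condition (oo')) or is not compensated by the other, differentiable, terms. *)
Lemma node_not_max L K n w k :
  strictly_concave_kernel L -> strictly_concave_kernel K ->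
  (cond_infty' K \/ (C1_open K /\ C1_open L)) -> (1 <= k <= n)%nat ->
  0 < expF L K n w (w k) -> exists t, expF L K n w (w k) < expF L K n w t.
Proof.
intros SL SK HC Hk Hpos. pose proof SL as [HL _]. pose proof SK as [HK _].
set (c := w k) in *.
destruct (expF_pos_inv L K n w c HL HK Hpos) as [PL PK].
assert (P0 : 0 < ek K 0). { specialize (PK k Hk). unfold c in PK. now rewrite Rminus_diag in PK. }
destruct (expF_locally_pos L K n w c HL HK Hpos) as (r0 & Hr0 & Hloc).
destruct HC as [HC|[CK CL]].
- destruct (cond_infty'_slope K HK HC P0) as (s & Hs & HA).
  assert (Habs : forall h, 0 < h -> Rabs (s * h) = h).
  { intros h Hh. rewrite Rabs_mult. rewrite (Rabs_right h) by lra.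
    destruct Hs as [-> | ->]; [rewrite Rabs_R1|rewrite Rabs_left by lra]; ring. }
  assert (Hlow : forall Q u, strictly_concave_kernel Q -> 0 < ek Q u ->
     exists b, lower_slope (fun h => Kr Q (u + s * h) - Kr Q u) b).
  { intros Q u SQ Hu. destruct (kernel_lower_lipschitz Q u SQ Hu) as (B & r & Hr & H).
    exists (- B), r. split; [easy|]. intros h Hh.
    specialize (H (s * h)). rewrite Habs in H by lra. specialize (H ltac:(lra)). lra. }
  destruct (Hlow L c SL PL) as [bL HbL].
  destruct (choice (fun i b => (1 <= i <= n)%nat -> lower_slope (fun h => Kr K (c - w i + s * h) - Kr K (c - w i)) b)) as [b Hb].
  { intros i. destruct (classic (1 <= i <= n)%nat) as [Hi|Hi].
    - destruct (Hlow K (c - w i) SK (PK i Hi)) as [b Hb]. now exists b.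
    - exists 0. easy. }
  (* The slope demanded of the [k]-th translate outweighs the bounds of all other terms and leaves a
     total slope of 1. *)
  pose (A := 1 - bL - sm (fun i => if Nat.eqb i k then 0 else b i) n).
  pose (b' := fun i => if Nat.eqb i k then A else b i).
  destruct (lower_slope_add _ _ _ _ HbL
    (lower_slope_sm (fun i h => Kr K (c - w i + s * h) - Kr K (c - w i)) b' n ltac:(
      intros i Hi; unfold b'; destruct (Nat.eqb_spec i k) as [->|]; [
        unfold c; rewrite Rminus_diag; destruct (HA A) as (r & Hr & H); exists r; split; [easy|];
        intros h Hh; rewrite Rplus_0_l; auto
      | now apply Hb]))) as (r & Hr & H).
  assert (Eb : bL + sm b' n = 1).
  { rewrite (sm_split b' n k Hk). unfold b' at 1. rewrite Nat.eqb_refl.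
    rewrite (sm_ext _ (fun i => if Nat.eqb i k then 0 else b i)); [unfold A; ring|].
    intros i Hi. unfold b'. now destruct (Nat.eqb i k). }
  rewrite Eb in H. pose (h := Rmin (r / 2) (r0 / 2)).
  assert (Hh : 0 < h < r /\ h < r0).
  { unfold h. pose proof (Rmin_l (r / 2) (r0 / 2)); pose proof (Rmin_r (r / 2) (r0 / 2)).
    assert (0 < Rmin (r / 2) (r0 / 2)) by (apply Rmin_glb_lt; lra). lra. }
  exists (c + s * h). apply expF_lt_Fr; auto.
  + apply Hloc. rewrite Habs; lra.
  + specialize (H h ltac:(lra)).
    assert (E := sm_lin 1 (-1) (fun i => Kr K (c - w i + s * h)) (fun i => Kr K (c - w i)) n).
    rewrite (sm_ext _ (fun i => Kr K (c - w i + s * h) - Kr K (c - w i))) in E by (intros; ring).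
    unfold Fr. rewrite (sm_ext (fun i => Kr K (c + s * h - w i)) (fun i => Kr K (c - w i + s * h)))
      by (intros; f_equal; ring). lra.
- destruct (kernel_kink K SK P0) as (s & Hs & Hkink).
  (* In the symmetric second difference the smooth terms lose at most [(n + 1) * eps * h = s * h]
     altogether, while the kink gains [2 * s * h]. *)
  pose (eps := s / (INR n + 1)).
  assert (Hn := pos_INR n).
  assert (Heps : 0 < eps) by (apply Rdiv_lt_0_compat; lra).
  pose (b := fun i => if Nat.eqb i k then 2 * s else - eps).
  assert (HbL := kernel_second_difference L c eps SL CL PL Heps).
  assert (HbK : lower_slope (fun h => sm (fun i => (Kr K (c - w i + h) - Kr K (c - w i)) + (Kr K (c - w i - h) - Kr K (c - w i))) n) (sm b n)).
  { apply (lower_slope_sm (fun i h => (Kr K (c - w i + h) - Kr K (c - w i)) + (Kr K (c - w i - h) - Kr K (c - w i)))).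
    intros i Hi. unfold b. destruct (Nat.eqb_spec i k) as [->|].
    - unfold c; rewrite Rminus_diag. exists PI. split; [apply PI_RGT_0|]. intros h Hh.
      pose proof (Hkink h) as H1. pose proof (Hkink (- h)) as H2. rewrite Rabs_Ropp in H2. rewrite (Rabs_right h) in H1, H2 by lra.
      specialize (H1 ltac:(lra)). specialize (H2 ltac:(lra)). rewrite Rplus_0_l, Rminus_0_l. lra.
    - apply kernel_second_difference; auto. }
  destruct (lower_slope_add _ _ _ _ HbL HbK) as (r & Hr & H).
  assert (Eb : 0 < - eps + sm b n).
  { rewrite (sm_split b n k Hk). unfold b at 1. rewrite Nat.eqb_refl.
    assert (Hc : sm (fun _ => - eps) n <= sm (fun i => if Nat.eqb i k then 0 else b i) n).
    { apply sm_le. intros i Hi. unfold b. destruct (Nat.eqb i k); lra. }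
    assert (Ec : forall e p, sm (fun _ => - e) p = - (INR p * e)).
    { clear. intros e p. induction p as [|p IH]; [simpl; ring|]. rewrite S_INR. simpl sm. rewrite IH; ring. }
    rewrite Ec in Hc.
    assert (Es : eps * (INR n + 1) = s) by (unfold eps; field; lra). nra. }
  pose (h := Rmin (r / 2) (r0 / 2)).
  assert (Hh : 0 < h < r /\ h < r0).
  { unfold h. pose proof (Rmin_l (r / 2) (r0 / 2)); pose proof (Rmin_r (r / 2) (r0 / 2)).
    assert (0 < Rmin (r / 2) (r0 / 2)) by (apply Rmin_glb_lt; lra). lra. }
  specialize (H h ltac:(lra)).
  assert (HF : 0 < (Fr L K n w (c + h) - Fr L K n w c) + (Fr L K n w (c + - h) - Fr L K n w c)).
  { assert (E : sm (fun i => (Kr K (c - w i + h) - Kr K (c - w i)) + (Kr K (c - w i - h) - Kr K (c - w i))) n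
      = sm (fun i => Kr K (c - w i + h)) n + sm (fun i => Kr K (c - w i - h)) n - 2 * sm (fun i => Kr K (c - w i)) n).
    { rewrite (sm_ext _ (fun i => 1 * (1 * Kr K (c - w i + h) + 1 * Kr K (c - w i - h)) + (-2) * Kr K (c - w i)))
        by (intros; ring).
      rewrite !sm_lin; ring. }
    unfold Fr.
    rewrite (sm_ext (fun i => Kr K (c + h - w i)) (fun i => Kr K (c - w i + h))) by (intros; f_equal; ring).
    rewrite (sm_ext (fun i => Kr K (c + - h - w i)) (fun i => Kr K (c - w i - h))) by (intros; f_equal; ring).
    replace (c + - h) with (c - h) by ring. nra. }
  destruct (Rlt_or_le (Fr L K n w c) (Fr L K n w (c + h))) as [Hlt|Hle].
  + exists (c + h). apply expF_lt_Fr; auto. apply Hloc. rewrite Rabs_right; lra.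
  + exists (c + - h). apply expF_lt_Fr; auto; [|lra]. apply Hloc. rewrite Rabs_Ropp, Rabs_right; lra.
Qed.

(** * Existence of a minimiser *)

(** Gaussian elimination: a form [p] with nonzero last coefficient removes the last unknown from the
    others; if there is none, the last basis vector is a solution. *)
Lemma underdetermined_system n : forall l : list (nat -> R), (length l < n)%nat ->
  exists d, (exists i, (1 <= i <= n)%nat /\ d i <> 0) /\
    forall f, In f l -> sm (fun i => f i * d i) n = 0.
Proof.
induction n as [|n IH]; intros l Hl; [lia|].
assert (Hlast : forall (f d d' : nat -> R), (forall i, (1 <= i <= n)%nat -> d i = d' i) ->
  sm (fun i => f i * d i) (S n) = sm (fun i => f i * d' i) n + f (S n) * d (S n)).
{ intros f d d' H. simpl. f_equal. apply sm_ext. intros i Hi. now rewrite H. }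
destruct (classic (exists p, In p l /\ p (S n) <> 0)) as [(p & Hp & Hp0)|Hno].
- destruct (in_split p l Hp) as (l1 & l2 & ->).
  destruct (IH (map (fun f i => f i - f (S n) / p (S n) * p i) (l1 ++ l2))) as (d' & (i & Hi & Hd) & Hz).
  { rewrite length_map, length_app. rewrite length_app in Hl. simpl in Hl. lia. }
  pose (d := fun i => if Nat.eqb i (S n) then - sm (fun i => p i * d' i) n / p (S n) else d' i).
  assert (Ed : forall i, (1 <= i <= n)%nat -> d i = d' i).
  { intros k Hk. unfold d. destruct (Nat.eqb_spec k (S n)); [lia|easy]. }
  assert (Edl : d (S n) = - sm (fun i => p i * d' i) n / p (S n)) by (unfold d; now rewrite Nat.eqb_refl).
  exists d. split; [exists i; split; [lia|now rewrite Ed]|].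
  intros f Hf. rewrite (Hlast f d d' Ed), Edl.
  assert (Hcase : f = p \/ In f (l1 ++ l2)).
  { apply in_app_or in Hf. rewrite in_app_iff. destruct Hf as [Hf|[Hf|Hf]]; auto. }
  destruct Hcase as [->|Hf']; [now field|].
  specialize (Hz _ (in_map (fun f i => f i - f (S n) / p (S n) * p i) _ _ Hf')). cbv beta in Hz.
  rewrite (sm_ext _ (fun i => 1 * (f i * d' i) + (- (f (S n) / p (S n))) * (p i * d' i))) in Hz by (intros; ring).
  rewrite sm_lin in Hz.
  replace (f (S n) * (- sm (fun i => p i * d' i) n / p (S n))) with
    (- (f (S n) / p (S n)) * sm (fun i => p i * d' i) n) by (now field). lra.
- exists (fun i => if Nat.eqb i (S n) then 1 else 0). split.
  + exists (S n). rewrite Nat.eqb_refl. split; [lia|lra].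
  + intros f Hf. rewrite (Hlast f _ (fun _ => 0)).
    2:{ intros i Hi. destruct (Nat.eqb_spec i (S n)); [lia|easy]. }
    rewrite Nat.eqb_refl. replace (f (S n)) with 0.
    2:{ symmetry; apply NNPP. intros H; apply Hno; now exists f. }
    rewrite (sm_ext _ (fun i => 0 * 0 + 0 * 0)) by (intros; ring). rewrite (sm_lin 0 0 (fun _ => 0) (fun _ => 0)). ring.
Qed.

(** As many forms as unknowns may have only the trivial common zero. One form is set aside, a
    nontrivial zero of the rest is taken, and its sign is chosen to suit the form set aside. *)
Lemma nonneg_direction n (l : list (nat -> R)) : (1 <= n)%nat -> (length l <= n)%nat ->
  exists d, (exists i, (1 <= i <= n)%nat /\ d i <> 0) /\
    forall f, In f l -> 0 <= sm (fun i => f i * d i) n.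
Proof.
intros Hn Hl. destruct l as [|a l].
- destruct (underdetermined_system n nil Hn) as (d & Hd & _). exists d; split; [easy|]. intros f [].
- destruct (underdetermined_system n l Hl) as (d & (i & Hi & Hd) & Hz).
  destruct (Rle_or_lt 0 (sm (fun i => a i * d i) n)) as [Ha|Ha].
  + exists d. split; [now exists i|]. intros f [<-|Hf]; [easy|]. rewrite Hz; [lra|easy].
  + exists (fun i => - d i). split; [exists i; split; [easy|lra]|].
    assert (E : forall f, sm (fun i => f i * - d i) n = - sm (fun i => f i * d i) n).
    { intros f. rewrite (sm_ext _ (fun i => (-1) * (f i * d i) + 0 * 0)) by (intros; ring).
      rewrite (sm_lin (-1) 0 (fun i => f i * d i) (fun _ => 0)). ring. }
    intros f [<-|Hf]; rewrite E; [lra|]. rewrite Hz; [lra|easy].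
Qed.

(** The condition [k <= phi k] preserves limits and composes, which suffices for extracting one
    coordinate after another. *)
Lemma is_lim_seq_along (u : nat -> R) (l : Rbar) (phi : nat -> nat) :
  (forall k, (k <= phi k)%nat) -> is_lim_seq u l -> is_lim_seq (fun k => u (phi k)) l.
Proof.
intros Hphi Hu. apply (is_lim_seq_subseq u l phi); [|easy].
intros P [N HN]. exists N. intros k Hk. apply HN. specialize (Hphi k). lia.
Qed.

Lemma bounded_subsequence (u : nat -> R) a b : (forall k, a <= u k <= b) ->
  exists (phi : nat -> nat) (l : R), (forall k, (k <= phi k)%nat) /\ a <= l <= b /\ is_lim_seq (fun k => u (phi k)) l.
Proof.
intros Hu. destruct (Bolzano_Weierstrass u (fun c => a <= c <= b) (compact_P3 a b) Hu) as [l Hl].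
destruct (choice (fun k p => (k <= p)%nat /\ Rabs (u p - l) < / (INR k + 1))) as [phi Hphi].
{ intros k. assert (Hk : 0 < / (INR k + 1)) by (apply Rinv_0_lt_compat; pose proof (pos_INR k); lra).
  destruct (Hl (disc l (mkposreal _ Hk)) k) as (p & Hp & Hd); [now exists (mkposreal _ Hk)|]. exists p. now split. }
exists phi, l.
assert (Hlim : is_lim_seq (fun k => u (phi k)) l).
{ apply is_lim_seq_spec. intros eps.
  destruct (archimed_cor1 eps (cond_pos eps)) as (N & HN & HN0).
  exists N. intros k Hk. eapply Rlt_trans; [apply Hphi|].
  apply Rle_lt_trans with (/ INR N); [|easy].
  apply Rinv_le_contravar; [now apply lt_0_INR|]. apply le_INR in Hk. lra. }
split; [apply Hphi|]. split; [|easy].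
split.
- apply (is_lim_seq_le (fun _ => a) (fun k => u (phi k)) a l); [intros; apply Hu|apply is_lim_seq_const|easy].
- apply (is_lim_seq_le (fun k => u (phi k)) (fun _ => b) l b); [intros; apply Hu|easy|apply is_lim_seq_const].
Qed.

Lemma bounded_subsequence_vec n (u : nat -> nat -> R) a b :
  (forall k i, (1 <= i <= n)%nat -> a <= u k i <= b) ->
  exists (phi : nat -> nat) (l : nat -> R), (forall k, (k <= phi k)%nat) /\
    forall i, (1 <= i <= n)%nat -> a <= l i <= b /\ is_lim_seq (fun k => u (phi k) i) (l i).
Proof.
induction n as [|n IH]; intros Hu.
- exists (fun k => k), (fun _ => 0). split; [easy|]. intros; lia.
- destruct IH as (phi & l & Hphi & Hl). { intros k i Hi; apply Hu; lia. }
  destruct (bounded_subsequence (fun k => u (phi k) (S n)) a b) as (psi & l0 & Hpsi & Hl0 & Hlim).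
  { intros k; apply Hu; lia. }
  exists (fun k => phi (psi k)), (fun i => if Nat.eqb i (S n) then l0 else l i). split.
  + intros k. specialize (Hphi (psi k)). specialize (Hpsi k). lia.
  + intros i Hi. destruct (Nat.eqb_spec i (S n)) as [->|]; [now split|].
    destruct (Hl i) as [A B]; [lia|]. split; [easy|].
    now apply (is_lim_seq_along (fun k => u (phi k) i)).
Qed.

Lemma avoid_points n (y : nat -> R) a b : a < b ->
  exists a' b', a <= a' /\ a' < b' /\ b' <= b /\
    forall t i, (1 <= i <= n)%nat -> a' < t < b' -> t <> y i.
Proof.
induction n as [|n IH]; intros Hab.
- exists a, b. repeat split; try lra. intros; lia.
- destruct (IH Hab) as (a1 & b1 & H1 & H2 & H3 & H4).
  destruct (Rle_or_lt (y (S n)) ((a1 + b1) / 2)) as [H|H].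
  + exists ((a1 + b1) / 2), b1. repeat split; try lra. intros t i Hi Ht.
    destruct (Nat.eq_dec i (S n)) as [->|]; [lra|]. apply H4; [lia|lra].
  + exists a1, ((a1 + b1) / 2). repeat split; try lra. intros t i Hi Ht.
    destruct (Nat.eq_dec i (S n)) as [->|]; [lra|]. apply H4; [lia|lra].
Qed.

Lemma ek_pos_near K u : concave_kernel K -> - (2 * PI) < u < 2 * PI -> u <> 0 -> 0 < ek K u.
Proof.
intros HK Hu Hn. destruct (Rlt_or_le u 0) as [H|H].
- rewrite <- (ek_periodic K HK). apply ek_open; auto. unfold in_open; lra.
- apply ek_open; auto. unfold in_open; lra.
Qed.

(** This makes the minimal level positive, so that its logarithm is a finite candidate for
    [bigM]. *)
Lemma expF_pos_somewhere L K n w : concave_kernel L -> concave_kernel K ->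
  (forall i, (1 <= i <= n)%nat -> 0 <= w i <= 2 * PI) -> exists t, 0 < expF L K n w t.
Proof.
intros HL HK Hw. destruct (avoid_points n w 0 (2 * PI) two_PI_pos) as (a & b & H1 & H2 & H3 & H4).
exists ((a + b) / 2). rewrite expF_pos_exp; auto.
- apply exp_pos.
- apply ek_open; auto. unfold in_open; lra.
- intros i Hi. specialize (Hw i Hi). apply ek_pos_near; auto; [lra|].
  specialize (H4 ((a + b) / 2) i Hi). lra.
Qed.

(** The level [m] is [exp] of the minimax value. The lower bound ranges over all real vectors, so it
    applies to perturbations that are unsorted or outside the period. *)
Definition minimal (L K : R -> Rbar) (n : nat) (m : R) (w : nat -> R) : Prop :=
  0 < m /\ (forall t, expF L K n w t <= m) /\ forall y, exists t, m <= expF L K n y t.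

Lemma minimal_exists L K n : concave_kernel L -> concave_kernel K ->
  exists m w, inT n w /\ minimal L K n m w.
Proof.
intros HL HK.
(* The members of [E] are negated upper bounds, since completeness supplies suprema; the minimal
   level is [- m0]. *)
pose (E := fun a => exists y, inT n y /\ forall t, expF L K n y t <= - a).
destruct (completeness E) as [m0 [Hub Hlub]].
- exists 0. intros a (y & _ & Hy). specialize (Hy 0). pose proof (expF_ge0 L K n y 0). lra.
- destruct (expF_max_glob L K n (fun _ => 0) HL HK) as (z & _ & Hz).
  exists (- expF L K n (fun _ => 0) z). exists (fun _ => 0). split.
  + intros i _. pose proof two_PI_pos; lra.
  + rewrite Ropp_involutive. easy.
- assert (Hseq : forall k : nat, exists y, inT n y /\ forall t, expF L K n y t <= - m0 + / (INR k + 1)).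
  { intros k. apply NNPP. intros Hno.
    assert (Hk : 0 < / (INR k + 1)) by (apply Rinv_0_lt_compat; pose proof (pos_INR k); lra).
    assert (m0 <= m0 - / (INR k + 1)); [|lra]. apply Hlub. intros a (y & Hy & Hya).
    apply Rnot_lt_le. intros Hlt. apply Hno. exists y. split; [easy|]. intros t. specialize (Hya t). lra. }
  destruct (choice _ Hseq) as [y Hy].
  destruct (bounded_subsequence_vec n y 0 (2 * PI)) as (phi & w0 & Hphi & Hw0).
  { intros k i Hi. destruct (Hy k) as [H _]. specialize (H i Hi). lra. }
  assert (Hmax : forall t, expF L K n w0 t <= - m0).
  { intros t.
    apply (is_lim_seq_le (fun k => expF L K n (y (phi k)) t) (fun k => - m0 + / (INR (phi k) + 1))
      (expF L K n w0 t) (- m0)).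
    - intros k. apply Hy.
    - apply (expF_lim_seq L K n (fun k => y (phi k)) w0 (fun _ => t) t); auto.
      + intros i Hi; apply Hw0; auto.
      + apply is_lim_seq_const.
    - apply (is_lim_seq_along (fun k => - m0 + / (INR k + 1)) (- m0) phi Hphi).
      replace (Finite (- m0)) with (Rbar_plus (- m0) 0) by (simpl; f_equal; ring).
      apply is_lim_seq_plus'; [apply is_lim_seq_const|].
      replace (Finite 0) with (Rbar_inv p_infty) by reflexivity.
      apply is_lim_seq_inv; [|easy].
      eapply is_lim_seq_plus; [apply is_lim_seq_INR|apply is_lim_seq_const|easy]. }
  destruct (expF_reduce_y L K n w0 HL HK) as (w & Hw & Ew).
  exists (- m0), w. split; [easy|]. split; [|split].
  + destruct (expF_pos_somewhere L K n w0 HL HK) as [t Ht]. { intros i Hi; now apply Hw0. }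
    specialize (Hmax t). lra.
  + intros t. rewrite Ew. apply Hmax.
  + intros v. destruct (expF_reduce_y L K n v HL HK) as (v' & Hv' & Ev).
    destruct (expF_max_glob L K n v' HL HK) as (z & _ & Hz).
    exists z. rewrite <- Ev.
    assert (- expF L K n v' z <= m0); [|lra]. apply Hub. exists v'. split; [easy|].
    now rewrite Ropp_involutive.
Qed.

(** * Equioscillation and uniqueness *)

Definition sorted_nodes (n : nat) (v : nat -> R) : Prop :=
  forall k, (k <= n)%nat -> ext n v k <= ext n v (S k).

Lemma ext_0 n v : ext n v 0 = 0.
Proof. reflexivity. Qed.

Lemma ext_S n v : ext n v (S n) = 2 * PI.
Proof. unfold ext. simpl. now rewrite Nat.eqb_refl. Qed.

Lemma ext_mid n v i : (1 <= i <= n)%nat -> ext n v i = v i.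
Proof.
intros Hi. unfold ext. destruct (Nat.eqb_spec i 0); [lia|]. destruct (Nat.eqb_spec i (S n)); [lia|easy].
Qed.

Lemma sorted_mono n v i j : sorted_nodes n v -> (i <= j <= S n)%nat -> ext n v i <= ext n v j.
Proof.
intros Hs [Hij Hj]. induction Hij as [|j Hij IH]; [lra|].
apply Rle_trans with (ext n v j); [apply IH; lia|apply Hs; lia].
Qed.

Lemma sorted_range n v i : sorted_nodes n v -> (i <= S n)%nat -> 0 <= ext n v i <= 2 * PI.
Proof.
intros Hs Hi. split.
- rewrite <- (ext_0 n v). apply sorted_mono; auto; lia.
- rewrite <- (ext_S n v). apply sorted_mono; auto; lia.
Qed.

Lemma find_arc (a : nat -> R) n t : a 0%nat <= t <= a (S n) ->
  exists j, (j <= n)%nat /\ a j <= t <= a (S j).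
Proof.
induction n as [|n IH]; intros Ht; [exists 0%nat; auto|].
destruct (Rle_or_lt t (a (S n))) as [H|H].
- destruct IH as (j & Hj & H'); [lra|]. exists j; split; [lia|easy].
- exists (S n). split; [lia|lra].
Qed.

Lemma sorted_in_arc n v j t : sorted_nodes n v -> (j <= n)%nat -> ext n v j <= t <= ext n v (S j) -> in_arc n j v t.
Proof.
intros Hs Hj Ht.
pose proof (sorted_range n v j Hs ltac:(lia)). pose proof (sorted_range n v (S j) Hs ltac:(lia)).
split; [lra|]. intros i Hi. pose proof (sorted_range n v i Hs ltac:(lia)) as Hv.
unfold arc_shift. destruct (Nat.leb_spec i j) as [H'|H'].
- pose proof (sorted_mono n v i j Hs ltac:(lia)). rewrite ext_mid in * by easy. lra.
- pose proof (sorted_mono n v (S j) i Hs ltac:(lia)). rewrite (ext_mid n v i) in * by easy. lra.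
Qed.

Lemma eventually_forall (P : nat -> nat -> Prop) n :
  (forall i, (1 <= i <= n)%nat -> eventually (P i)) ->
  eventually (fun k => forall i, (1 <= i <= n)%nat -> P i k).
Proof.
induction n as [|n IH]; intros H; [exists 0%nat; intros; lia|].
assert (A := IH ltac:(intros; apply H; lia)). assert (B := H (S n) ltac:(lia)).
generalize (filter_and _ _ A B). clear A B.
apply filter_imp. intros k [A B] i Hi. destruct (Nat.eq_dec i (S n)) as [->|]; [easy|apply A; lia].
Qed.

Lemma is_lim_seq_eventually_between (u : nat -> R) (l a b : R) : is_lim_seq u l -> a < l < b ->
  eventually (fun k => a <= u k <= b).
Proof.
intros Hu Hl. apply (Hu (fun x => a <= x <= b)). assert (A := locally_gt l a ltac:(lra)). assert (B := locally_lt l b ltac:(lra)).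
change (locally l (fun x => a <= x <= b)). generalize (filter_and _ _ A B).
apply filter_imp. intros; lra.
Qed.

Lemma minimal_not_node L K n m w i :
  strictly_concave_kernel L -> strictly_concave_kernel K ->
  (cond_infty' K \/ (C1_open K /\ C1_open L)) -> minimal L K n m w -> (1 <= i <= n)%nat ->
  expF L K n w (w i) <> m.
Proof.
intros SL SK HC (Hm & Hmax & _) Hi E.
destruct (node_not_max L K n w i SL SK HC Hi) as [t Ht]; [lra|]. specialize (Hmax t). lra.
Qed.

(** Equality would put [z] at the node [w i] or a full period beyond it, hence a maximum at a node.
    Strictness is what lets the arc constraints survive a perturbation of [w] and [z]. *)
Lemma minimal_strict_arc L K n m w j z :
  strictly_concave_kernel L -> strictly_concave_kernel K ->
  (cond_infty' K \/ (C1_open K /\ C1_open L)) -> minimal L K n m w -> inT n w -> sorted_nodes n w ->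
  (j <= n)%nat -> ext n w j <= z <= ext n w (S j) -> expF L K n w z = m ->
  forall i, (1 <= i <= n)%nat -> 0 < z - w i + arc_shift j i < 2 * PI.
Proof.
intros SL SK HC Hmin Hw Hs Hj Hz Ez i Hi. pose proof SL as [HL _]; pose proof SK as [HK _].
destruct (sorted_in_arc n w j z Hs Hj Hz) as [Hz' Hi']. specialize (Hi' i Hi). specialize (Hw i Hi).
pose proof (minimal_not_node L K n m w i SL SK HC Hmin Hi) as Hn.
assert (z <> w i) by congruence.
assert (z <> w i + 2 * PI).
{ intros E. apply Hn. rewrite <- Ez, E. symmetry; now apply expF_periodic. }
unfold arc_shift in *. destruct (i <=? j)%nat; lra.
Qed.

(* Any [n] supergradients admit a common non-ascent direction in dimension [n]; strict concavity then
   lowers all the corresponding arc maxima, so no minimiser can have fewer than [n + 1] active arcs. *)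
Lemma minimal_equioscillation L K n m w :
  strictly_concave_kernel L -> strictly_concave_kernel K ->
  (cond_infty' K \/ (C1_open K /\ C1_open L)) -> minimal L K n m w -> inT n w -> sorted_nodes n w ->
  forall j, (j <= n)%nat -> ext n w j < ext n w (S j) /\
    exists z, ext n w j <= z <= ext n w (S j) /\ expF L K n w z = m.
Proof.
intros SL SK HC Hmin Hw Hs. pose proof SL as [HL _]; pose proof SK as [HK _].
pose proof Hmin as (Hm & Hmax & Hlow). pose proof two_PI_pos as HP.
destruct (Nat.eq_dec n 0) as [->|Hn].
{ intros j Hj. replace j with 0%nat by lia. rewrite ext_0, ext_S. split; [lra|].
  destruct (expF_max_glob L K 0 w HL HK) as (z & Hz & Hz'). exists z. split; [lra|].
  destruct (Hlow w) as [t Ht]. specialize (Hz' t). specialize (Hmax z). lra. }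
set (active := fun j => ext n w j < ext n w (S j) /\
    exists z, ext n w j <= z <= ext n w (S j) /\ expF L K n w z = m).
intros j0 Hj0. fold (active j0). apply NNPP. intros Hbad.
destruct (choice (fun j (k : nat -> R) => (j <= n)%nat -> active j -> forall y t, in_arc n j y t -> 0 < expF L K n y t ->
    expF L K n y t <= m * exp (- sm (fun i => k i * (y i - w i)) n))) as [kap Hkap].
{ intros j. destruct (classic ((j <= n)%nat /\ active j)) as [[Hj [Hj1 (z & Hz & Ez)]]|Hna].
  - destruct (arc_supergradient L K n j w z m) as [k Hk]; auto.
    + apply (sorted_in_arc n w j z Hs Hj Hz).
    + now apply (minimal_strict_arc L K n m w j z).
    + now exists k.
  - exists (fun _ => 0). intros Hj Ha. exfalso; auto. }
(* Without the arc [j0], supposed degenerate or inactive, exactly [n] forms in [n] unknowns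
   remain. *)
destruct (nonneg_direction n (map kap (seq 0 j0 ++ seq (S j0) (n - j0)))) as (d & (i0 & Hi0 & Hd0) & Hd).
{ lia. } { rewrite length_map, length_app, !length_seq. lia. }
assert (Hd' : forall j, (j <= n)%nat -> j <> j0 -> 0 <= sm (fun i => kap j i * d i) n).
{ intros j Hj Hne. apply Hd, in_map, in_or_app. rewrite !in_seq. lia. }
pose (s := fun k : nat => / (INR k + 1)).
assert (Hs0 : forall k, 0 < s k) by (intros k; apply Rinv_0_lt_compat; pose proof (pos_INR k); lra).
assert (Hslim : is_lim_seq s 0).
{ replace (Finite 0) with (Rbar_inv p_infty) by reflexivity. apply is_lim_seq_inv; [|easy].
  eapply is_lim_seq_plus; [apply is_lim_seq_INR|apply is_lim_seq_const|easy]. }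
pose (y := fun k i => w i + s k * d i).
assert (Hylim : forall i, is_lim_seq (fun k => y k i) (w i)).
{ intros i. replace (Finite (w i)) with (Finite (w i + 0 * d i)) by (f_equal; ring).
  apply is_lim_seq_plus'; [apply is_lim_seq_const|].
  apply is_lim_seq_mult'; [easy|apply is_lim_seq_const]. }
destruct (choice (fun k t => 0 <= t < 2 * PI /\ m <= expF L K n (y k) t)) as [t Ht].
{ intros k. destruct (Hlow (y k)) as [t Ht].
  destruct (expF_reduce_t L K n (y k) t HL HK) as (t' & Ht' & E). exists t'. split; [easy|lra]. }
destruct (bounded_subsequence t 0 (2 * PI)) as (phi & t0 & Hphi & Ht0 & Htlim).
{ intros k. destruct (Ht k). lra. }
(* High points of the perturbed configurations accumulate at a maximum point of [w], which selects
   the arc to work on. *)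
assert (Et0 : expF L K n w t0 = m).
{ apply Rle_antisym; [apply Hmax|].
  apply (is_lim_seq_le (fun _ => m) (fun k => expF L K n (y (phi k)) (t (phi k))) m (expF L K n w t0)).
  - intros k; apply Ht.
  - apply is_lim_seq_const.
  - apply (expF_lim_seq L K n (fun k => y (phi k)) w (fun k => t (phi k)) t0); auto.
    intros i Hi. now apply (is_lim_seq_along (fun k => y k i)). }
destruct (find_arc (ext n w) n t0) as (j & Hj & Htj). { now rewrite ext_0, ext_S. }
(* If this arc were a single point, [t0] would be a node of [K]: its left end, or its right end when
   [j = 0], because the left end is then the node of [L]. *)
assert (Hact : active j).
{ split; [|now exists t0]. apply Rnot_le_lt. intros Hle. assert (E : t0 = ext n w j /\ t0 = ext n w (S j)) by lra.
  destruct (Nat.eq_dec j 0) as [->|].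
  - destruct E as [_ E]. rewrite ext_mid in E by lia.
    apply (minimal_not_node L K n m w 1 SL SK HC Hmin); [lia|congruence].
  - destruct E as [E _]. rewrite ext_mid in E by lia.
    apply (minimal_not_node L K n m w j SL SK HC Hmin); [lia|congruence]. }
assert (Hjj : j <> j0) by congruence.
pose proof (minimal_strict_arc L K n m w j t0 SL SK HC Hmin Hw Hs Hj Htj Et0) as Hstrict.
assert (Hev : eventually (fun k => forall i, (1 <= i <= n)%nat ->
   0 <= t (phi k) - y (phi k) i + arc_shift j i <= 2 * PI)).
{ apply (eventually_forall (fun i k => 0 <= t (phi k) - y (phi k) i + arc_shift j i <= 2 * PI)).
  intros i Hi. apply is_lim_seq_eventually_between with (t0 - w i + arc_shift j i); [|now apply Hstrict].
  apply is_lim_seq_plus'; [|apply is_lim_seq_const]. apply is_lim_seq_minus'; [easy|].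
  now apply (is_lim_seq_along (fun k => y k i)). }
destruct Hev as [N HN]. specialize (HN N (Nat.le_refl N)).
set (p := phi N) in *. destruct (Ht p) as [Htp Hmp].
assert (A1 : in_arc n j w t0) by (apply sorted_in_arc; auto).
assert (A2 : in_arc n j (y p) (t p)) by (split; [lra|easy]).
(* The direction [d] is only known not to raise the supergradient bound; strictness is gained at the
   midpoint of [w] and [y p], which concavity lifts above [m] while the bound keeps it at most
   [m]. *)
pose proof (expF_arc_concave L K n j w (y p) t0 (t p) (/ 2) m SL SK A1 A2 ltac:(lra) Hm ltac:(lra) Hmp) as Hbig.
assert (Hne : w i0 <> y p i0).
{ unfold y. intros E. assert (s p * d i0 = 0) as E' by lra. apply Rmult_integral in E'. pose proof (Hs0 p). lra. }
assert (Hgt := Hbig (ex_intro _ i0 (conj Hi0 Hne))). clear Hbig.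
assert (A3 : in_arc n j (fun i => / 2 * w i + (1 - / 2) * y p i) (/ 2 * t0 + (1 - / 2) * t p)).
{ destruct A1 as [A1 A1'], A2 as [A2 A2']. split; [lra|]. intros i Hi. specialize (A1' i Hi); specialize (A2' i Hi). lra. }
pose proof (Hkap j Hj Hact _ _ A3 ltac:(lra)) as Hle. cbv beta in Hle.
rewrite (sm_ext _ (fun i => (/ 2 * s p) * (kap j i * d i) + 0 * 0)) in Hle by (intros; unfold y; field).
rewrite (sm_lin _ 0 (fun i => kap j i * d i) (fun _ => 0)) in Hle.
specialize (Hd' j Hj Hjj). specialize (Hs0 p).
assert (Hexp : exp (- (/ 2 * s p * sm (fun i => kap j i * d i) n + 0 * sm (fun _ => 0) n)) <= 1).
{ rewrite <- exp_0. set (q := sm (fun i => kap j i * d i) n) in *.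
  assert (- (/ 2 * s p * q + 0 * sm (fun _ => 0) n) <= 0) as [Hl|He] by nra; [left; now apply exp_increasing|right; now rewrite He]. }
nra.
Qed.

Lemma positive_lower_bound (a : nat -> R) n : (forall k, (k <= n)%nat -> 0 < a k) ->
  exists e, 0 < e /\ forall k, (k <= n)%nat -> e <= a k.
Proof.
induction n as [|n IH]; intros H.
- exists (a 0%nat). split; [now apply H|]. intros k Hk. replace k with 0%nat by lia. lra.
- destruct IH as (e & He & Hk). { intros k Hk; apply H; lia. }
  exists (Rmin e (a (S n))). split; [apply Rmin_glb_lt; [easy|now apply H]|].
  intros k Hk'. destruct (Nat.eq_dec k (S n)) as [->|]; [apply Rmin_r|].
  apply Rle_trans with e; [apply Rmin_l|apply Hk; lia].
Qed.

(* Moving [w] slightly away from [x] would, by concavity, lower every arc maximum below [m]. *)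
Lemma minimal_unique L K n m w x :
  strictly_concave_kernel L -> strictly_concave_kernel K -> minimal L K n m w ->
  (forall j, (j <= n)%nat -> ext n w j < ext n w (S j)) -> sorted_nodes n x ->
  (forall j, (j <= n)%nat -> exists z, ext n x j <= z <= ext n x (S j) /\ m <= expF L K n x z) ->
  forall i, (1 <= i <= n)%nat -> x i = w i.
Proof.
intros SL SK (Hm & Hmax & Hlow) Hw Hx Hz. pose proof SL as [HL _]; pose proof SK as [HK _].
pose proof two_PI_pos as HP.
apply NNPP. intros Hno. apply not_all_ex_not in Hno. destruct Hno as [i0 Hno].
apply imply_to_and in Hno. destruct Hno as [Hi0 Hne].
destruct (positive_lower_bound (fun j => ext n w (S j) - ext n w j) n) as (e & He & Hgap).
{ intros k Hk. specialize (Hw k Hk). lra. }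
(* No gap of [x] exceeds [2 * PI], so subtracting [s] times it costs at most [e], the lower bound
   for the gaps of [w]: the extrapolated [y] stays sorted. *)
pose (s := e / (2 * PI)). assert (Hs : 0 < s) by (apply Rdiv_lt_0_compat; lra).
assert (Es : s * (2 * PI) = e) by (unfold s; field; lra).
pose (y := fun i => (1 + s) * w i - s * x i).
assert (Ey : forall k, (k <= S n)%nat -> ext n y k = (1 + s) * ext n w k - s * ext n x k).
{ intros k Hk. destruct (Nat.eq_dec k 0) as [->|]; [rewrite !ext_0; ring|].
  destruct (Nat.eq_dec k (S n)) as [->|]; [rewrite !ext_S; ring|]. rewrite !ext_mid by lia. easy. }
assert (Hy : sorted_nodes n y).
{ intros k Hk. rewrite !Ey by lia. specialize (Hgap k Hk). cbv beta in Hgap. specialize (Hx k Hk) as Hxk.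
  pose proof (sorted_range n x k Hx ltac:(lia)). pose proof (sorted_range n x (S k) Hx ltac:(lia)).
  assert (s * (ext n x (S k) - ext n x k) <= s * (2 * PI)) by (apply Rmult_le_compat_l; lra). nra. }
destruct (Hlow y) as [t' Ht']. destruct (expF_reduce_t L K n y t' HL HK) as (t & Ht & Et).
destruct (find_arc (ext n y) n t) as (j & Hj & Htj). { rewrite ext_0, ext_S; lra. }
destruct (Hz j Hj) as (z & Hzj & Hmz).
assert (Hl : 0 < / (1 + s) < 1).
{ split; [apply Rinv_0_lt_compat; lra|]. rewrite <- Rinv_1. apply Rinv_lt_contravar; lra. }
assert (Hgt : m < expF L K n (fun i => / (1 + s) * y i + (1 - / (1 + s)) * x i) (/ (1 + s) * t + (1 - / (1 + s)) * z)).
{ apply (expF_arc_concave L K n j); auto.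
  - now apply sorted_in_arc.
  - now apply sorted_in_arc.
  - lra.
  - exists i0. split; [easy|]. unfold y. intros E. apply Hne.
    apply (Rmult_eq_reg_l (1 + s)); lra. }
rewrite (expF_ext L K n _ w) in Hgt.
2:{ intros i Hi. unfold y. field. lra. }
specialize (Hmax (/ (1 + s) * t + (1 - / (1 + s)) * z)). lra.
Qed.

Lemma minimal_equidistant K n m w :
  strictly_concave_kernel K -> (cond_infty' K \/ (C1_open K /\ C1_open K)) ->
  minimal K K n m w -> inT n w -> sorted_nodes n w ->
  forall j, (1 <= j <= n)%nat -> w j = 2 * PI * INR j / INR (S n).
Proof.
intros SK HC Hmin Hw Hs j Hj. pose proof SK as [HK _]. pose proof two_PI_pos as HP.
pose proof (minimal_equioscillation K K n m w SK SK HC Hmin Hw Hs) as Hequi.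
(* After the rotation the node [w 1] sits at 0 and takes the place of the node of [L = K], while the
   former node of [L], read as [2 * PI], becomes the last free node. *)
pose (x := fun k => ext n w (S k) - w 1%nat).
assert (Hstep : forall k, (k <= n)%nat -> ext n w k < ext n w (S k)) by (intros k Hk; now apply Hequi).
assert (E1 : ext n w 1 = w 1%nat) by (apply ext_mid; lia).
assert (Hw1 : 0 < w 1%nat) by (rewrite <- E1, <- (ext_0 n w); apply Hstep; lia).
assert (Hx : inT n x).
{ intros k Hk. unfold x. pose proof (sorted_range n w (S k) Hs ltac:(lia)).
  pose proof (sorted_mono n w 1 (S k) Hs ltac:(lia)). lra. }
assert (Hxs : sorted_nodes n x).
{ intros k Hk. destruct (Nat.eq_dec k 0) as [->|].
  - rewrite ext_0, ext_mid by lia. apply Hx; lia.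
  - destruct (Nat.eq_dec k n) as [->|].
    + rewrite ext_S, ext_mid by lia. left; apply Hx; lia.
    + rewrite !ext_mid by lia. unfold x. specialize (Hs (S k) ltac:(lia)). lra. }
assert (Ex : forall t, expF K K n x t = expF K K n w (t + w 1%nat)).
{ intros t. rewrite !expF_eq by easy.
  (* The invariant matches [ek K t] and the first [p] rotated factors with the first [p + 1]
     original ones; for [p = n] the extra factor belongs to [2 * PI], that is, to the node 0 of
     [L]. *)
  assert (Hind : forall p, (p <= n)%nat ->
     ek K t * ebar (sumK K x t p) * 1 = ek K (t + w 1%nat - ext n w (S p)) * ebar (sumK K w (t + w 1%nat) p)).
  { induction p as [|p IH]; intros Hp.
    - simpl ebar. rewrite E1. replace (t + w 1%nat - w 1%nat) with t by ring. ring.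
    - rewrite !ebar_sumK_S by easy.
      replace (ek K t * (ebar (sumK K x t p) * ek K (t - x (S p))) * 1) with
        (ek K t * ebar (sumK K x t p) * 1 * ek K (t - x (S p))) by ring.
      rewrite IH by lia. rewrite (ext_mid n w (S p)) by lia. unfold x.
      replace (t - (ext n w (S (S p)) - w 1%nat)) with (t + w 1%nat - ext n w (S (S p))) by ring. ring. }
  specialize (Hind n (Nat.le_refl n)). rewrite Rmult_1_r in Hind. rewrite Hind, ext_S. f_equal.
  rewrite <- (ek_periodic K HK). f_equal; ring. }
assert (Hxmin : minimal K K n m x).
{ destruct Hmin as (Hm & Hmax & Hlow). split; [easy|]. split; [|easy]. intros t. rewrite Ex. apply Hmax. }
pose proof (minimal_equioscillation K K n m x SK SK HC Hxmin Hx Hxs) as Hequix.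
assert (Heq : forall i, (1 <= i <= n)%nat -> x i = w i).
{ apply (minimal_unique K K n m w x); auto.
  intros i Hi. destruct (Hequix i Hi) as [_ (z & Hz & E)]. exists z. split; [easy|lra]. }
assert (Hlin : forall i, (i <= S n)%nat -> ext n w i = INR i * w 1%nat).
{ induction i as [|i IH]; intros Hi; [rewrite ext_0; simpl; ring|].
  destruct (Nat.eq_dec i 0) as [->|]; [rewrite E1; simpl; ring|].
  rewrite S_INR. assert (H := Heq i ltac:(lia)). unfold x in H.
  rewrite <- (ext_mid n w i), IH in H by lia. lra. }
assert (HS := Hlin (S n) (Nat.le_refl _)). rewrite ext_S in HS.
rewrite <- (ext_mid n w j), Hlin by lia.
assert (0 < INR (S n)) by (apply lt_0_INR; lia).
rewrite HS. field. lra.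
Qed.

(** * Sorting and the extended-real statement *)

Lemma perm_on_Permutation n s : perm_on n s -> Permutation (map s (seq 1 n)) (seq 1 n).
Proof.
intros [Hr Hi]. apply NoDup_Permutation_bis.
- apply NoDup_map_NoDup_ForallPairs; [|apply seq_NoDup].
  intros i j H1 H2. apply in_seq in H1, H2. apply Hi; lia.
- rewrite length_map. lia.
- intros j Hj. apply in_map_iff in Hj. destruct Hj as (i & <- & Hin). apply in_seq in Hin.
  apply in_seq. specialize (Hr i). lia.
Qed.

(** Sorting a second minimiser yields [w' (s i) = w i], whereas uniqueness expresses [w'] through
    [w]. *)
Lemma perm_on_inverse n s : perm_on n s ->
  exists s', perm_on n s' /\ forall j, (1 <= j <= n)%nat -> s (s' j) = j.
Proof.
intros Hs.
destruct (choice (fun j i => (1 <= j <= n)%nat -> (1 <= i <= n)%nat /\ s i = j)) as [s' Hs'].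
{ intros j. destruct (classic (1 <= j <= n)%nat) as [Hj|]; [|now exists 0%nat].
  assert (Hin : In j (map s (seq 1 n))).
  { apply (Permutation_in j (Permutation_sym (perm_on_Permutation n s Hs))). apply in_seq; lia. }
  apply in_map_iff in Hin. destruct Hin as (i & E & Hi). apply in_seq in Hi. exists i. split; [lia|easy]. }
exists s'. split; [split|].
- intros j Hj. now apply Hs'.
- intros i j Hi Hj E. rewrite <- (proj2 (Hs' i Hi)), <- (proj2 (Hs' j Hj)). now rewrite E.
- intros j Hj. now apply Hs'.
Qed.

Lemma fold_Rmult_Permutation (l l' : list R) : Permutation l l' -> fold_right Rmult 1 l = fold_right Rmult 1 l'.
Proof. induction 1; simpl; try congruence; ring. Qed.

Lemma ebar_sumK_fold K y t n : concave_kernel K ->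
  ebar (sumK K y t n) = fold_right Rmult 1 (map (fun i => ek K (t - y i)) (seq 1 n)).
Proof.
intros HK. induction n as [|n IH]; [simpl; apply exp_0|].
rewrite ebar_sumK_S, IH, seq_S, map_app, fold_right_app by easy. simpl. rewrite Rmult_1_r.
generalize (map (fun i => ek K (t - y i)) (seq 1 n)). intros l.
induction l as [|a l IHl]; simpl; [ring|]. rewrite <- IHl. ring.
Qed.

Lemma expF_perm L K n y s t : concave_kernel L -> concave_kernel K -> perm_on n s ->
  expF L K n (fun i => y (s i)) t = expF L K n y t.
Proof.
intros HL HK Hs. rewrite !expF_eq, !ebar_sumK_fold by easy. f_equal.
rewrite <- (map_map s (fun i => ek K (t - y i))).
apply fold_Rmult_Permutation, Permutation_map, perm_on_Permutation, Hs.
Qed.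

(** The third clause strengthens the induction: it allows the old head to be put back in front after
    the insertion into the tail. *)
Lemma insert_sorted (y : nat -> R) a l : Sorted (fun i j => y i <= y j) l ->
  exists l', Permutation (a :: l) l' /\ Sorted (fun i j => y i <= y j) l' /\
    forall c, y c <= y a -> HdRel (fun i j => y i <= y j) c l -> HdRel (fun i j => y i <= y j) c l'.
Proof.
induction l as [|b l IH]; intros Hs.
- exists (a :: nil). repeat split; auto.
- destruct (Rle_or_lt (y a) (y b)) as [H|H].
  + exists (a :: b :: l). repeat split; auto.
  + apply Sorted_inv in Hs. destruct Hs as [Hs Hb].
    destruct (IH Hs) as (l' & Hp & Hs' & Hh). exists (b :: l'). split; [|split].
    * apply perm_trans with (b :: a :: l); [apply perm_swap|now apply perm_skip].
    * constructor; [easy|]. apply Hh; [lra|easy].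
    * intros c Hc Hcb. apply HdRel_inv in Hcb. now constructor.
Qed.

Lemma sort_exists (y : nat -> R) l : exists l', Permutation l l' /\ Sorted (fun i j => y i <= y j) l'.
Proof.
induction l as [|a l (l' & Hp & Hs)]; [exists nil; auto|].
destruct (insert_sorted y a l' Hs) as (l2 & Hp2 & Hs2 & _). exists l2. split; [|easy].
apply perm_trans with (a :: l'); [now apply perm_skip|easy].
Qed.

Lemma Sorted_nth (y : nat -> R) l k : Sorted (fun i j => y i <= y j) l -> (S k < length l)%nat ->
  y (nth k l 0%nat) <= y (nth (S k) l 0%nat).
Proof.
revert k. induction l as [|a l IH]; intros k Hs Hk; [simpl in Hk; lia|].
apply Sorted_inv in Hs. destruct Hs as [Hs Ha]. destruct k as [|k].
- destruct l as [|b l]; [simpl in Hk; lia|]. now apply HdRel_inv in Ha.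
- change (y (nth k l 0%nat) <= y (nth (S k) l 0%nat)). apply IH; [easy|simpl in Hk; lia].
Qed.

Lemma ext_sext n y s k : perm_on n s -> (k <= S n)%nat ->
  ext n y (sext n s k) = ext n (fun i => y (s i)) k.
Proof.
intros [Hr _] Hk. unfold sext.
destruct (Nat.eqb_spec k 0) as [->|]; [reflexivity|].
destruct (Nat.eqb_spec k (S n)) as [->|]; [now rewrite !ext_S|].
rewrite !ext_mid; [easy|lia|apply Hr; lia].
Qed.

Lemma is_sorting_sorted n y s : is_sorting n y s <-> perm_on n s /\ sorted_nodes n (fun i => y (s i)).
Proof.
split; intros [Hp H]; (split; [easy|]); intros k Hk; specialize (H k Hk).
- now rewrite !ext_sext in H by (auto; lia).
- now rewrite !ext_sext by (auto; lia).
Qed.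

Lemma sorting_exists n y : inT n y -> exists s, is_sorting n y s.
Proof.
intros Hy. destruct (sort_exists y (seq 1 n)) as (l & Hp & Hs).
assert (Hlen : length l = n) by (rewrite <- (Permutation_length Hp); apply length_seq).
pose (s := fun k => nth (k - 1) l 0%nat).
assert (Hperm : perm_on n s).
{ split.
  - intros j Hj. assert (Hin : In (s j) (seq 1 n)).
    { apply (Permutation_in _ (Permutation_sym Hp)). apply nth_In. lia. }
    apply in_seq in Hin. lia.
  - intros i j Hi Hj E.
    assert (i - 1 = j - 1)%nat; [|lia].
    assert (Hnd : NoDup l) by (apply (Permutation_NoDup Hp), seq_NoDup).
    apply (proj1 (NoDup_nth l 0%nat) Hnd); [lia|lia|easy]. }
exists s. apply is_sorting_sorted. split; [easy|]. intros k Hk. pose proof two_PI_pos as HP.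
assert (Hv : forall i, (1 <= i <= n)%nat -> 0 <= y (s i) < 2 * PI) by (intros i Hi; apply Hy, Hperm, Hi).
destruct (Nat.eq_dec k 0) as [->|Hk0].
- rewrite ext_0. destruct (Nat.eq_dec n 0) as [->|]; [rewrite ext_S; lra|].
  rewrite ext_mid by lia. apply Hv; lia.
- destruct (Nat.eq_dec k n) as [->|].
  + rewrite ext_S, ext_mid by lia. left; apply Hv; lia.
  + rewrite !ext_mid by lia. unfold s. replace (S k - 1)%nat with (S (k - 1)) by lia.
    apply Sorted_nth; [easy|lia].
Qed.

Lemma sort_perm_sorting n y : inT n y -> is_sorting n y (sort_perm n y).
Proof. intros Hy. unfold sort_perm. apply epsilon_spec. now apply sorting_exists. Qed.

Lemma supB_attained {A : Type} (P : A -> Prop) (f : A -> Rbar) z :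
  P z -> (forall x, P x -> Rbar_le (f x) (f z)) -> supB P f = f z.
Proof.
intros Hz H. apply Rbar_is_lub_unique. split.
- intros v (x & Hx & ->). now apply H.
- intros b Hb. apply Hb. now exists z.
Qed.

Lemma infB_attained {A : Type} (P : A -> Prop) (f : A -> Rbar) z :
  P z -> (forall x, P x -> Rbar_le (f z) (f x)) -> infB P f = f z.
Proof.
intros Hz H. apply Rbar_is_glb_unique. split.
- intros v (x & Hx & ->). now apply H.
- intros b Hb. apply Hb. now exists z.
Qed.

Lemma infB_le {A : Type} (P : A -> Prop) (f : A -> Rbar) z : P z -> Rbar_le (infB P f) (f z).
Proof.
intros Hz. unfold infB.
destruct (Rbar_ex_glb (fun v => exists x, P x /\ v = f x)) as [g Hg].
rewrite (Rbar_is_glb_unique _ _ Hg). apply Hg. now exists z.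
Qed.

Lemma F_le_expF L K n y t y' t' : concave_kernel L -> concave_kernel K ->
  (Rbar_le (F L K n y t) (F L K n y' t') <-> expF L K n y t <= expF L K n y' t').
Proof. intros HL HK. apply ebar_le; now apply F_not_p. Qed.

Lemma F_eq_ln L K n y t m : concave_kernel L -> concave_kernel K -> 0 < m ->
  (F L K n y t = Finite (ln m) <-> expF L K n y t = m).
Proof.
intros HL HK Hm. unfold expF. split; intros E.
- rewrite E. now apply exp_ln.
- apply Rbar_le_antisym; apply ebar_le; try (now apply F_not_p); try easy;
    simpl; rewrite exp_ln; lra.
Qed.

Lemma supF_attained L K n y : concave_kernel L -> concave_kernel K ->
  exists z, 0 <= z < 2 * PI /\ supF L K n y = F L K n y z /\ forall t, expF L K n y t <= expF L K n y z.
Proof.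
intros HL HK. destruct (expF_max_glob L K n y HL HK) as (z & Hz & H). exists z. split; [easy|]. split; [|easy].
apply supB_attained; [easy|]. intros t _. now apply F_le_expF.
Qed.

Lemma msig_attained L K n y s k : concave_kernel L -> concave_kernel K -> is_sorting n y s -> (k <= n)%nat ->
  exists z, ext n (fun i => y (s i)) k <= z <= ext n (fun i => y (s i)) (S k) /\
    msig L K n y s k = F L K n y z /\
    forall t, ext n (fun i => y (s i)) k <= t <= ext n (fun i => y (s i)) (S k) -> expF L K n y t <= expF L K n y z.
Proof.
intros HL HK Hs Hk. apply is_sorting_sorted in Hs. destruct Hs as [Hp Hs].
destruct (expF_max L K n y _ _ HL HK (Hs k Hk)) as (z & Hz & H). exists z. split; [easy|]. split; [|easy].
unfold msig. rewrite !ext_sext by (auto; lia).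
apply supB_attained; [easy|]. intros t Ht. apply F_le_expF; auto.
Qed.

Lemma mbar_intervals_supF L K n y : concave_kernel L -> concave_kernel K -> inT n y ->
  mbar_intervals L K n y = supF L K n y.
Proof.
intros HL HK Hy. pose proof (sort_perm_sorting n y Hy) as Hs. unfold mbar_intervals.
set (s := sort_perm n y) in *.
destruct (supF_attained L K n y HL HK) as (z & Hz & -> & Hmax).
destruct (find_arc (ext n (fun i => y (s i))) n z) as (k & Hk & Hzk). { rewrite ext_0, ext_S; lra. }
destruct (msig_attained L K n y s k HL HK Hs Hk) as (zk & Hzk' & Ek & Hmk).
assert (E : msig L K n y s k = F L K n y z).
{ rewrite Ek. apply Rbar_le_antisym; apply F_le_expF; auto. }
rewrite <- E. apply (supB_attained (fun k => (k <= n)%nat) (msig L K n y s) k Hk).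
intros j Hj. destruct (msig_attained L K n y s j HL HK Hs Hj) as (zj & _ & -> & _).
rewrite E. apply F_le_expF; auto.
Qed.

Lemma minimal_perm L K n m w s : concave_kernel L -> concave_kernel K -> perm_on n s ->
  minimal L K n m w -> minimal L K n m (fun i => w (s i)).
Proof.
intros HL HK Hs (Hm & Hmax & Hlow). split; [easy|]. split; [|easy].
intros t. rewrite expF_perm by easy. apply Hmax.
Qed.

Lemma inT_perm n w s : perm_on n s -> inT n w -> inT n (fun i => w (s i)).
Proof. intros [Hs _] Hw i Hi. apply Hw, Hs, Hi. Qed.

Theorem theorem11p6 (L K : R -> Rbar) (n : nat) :
  strictly_concave_kernel L -> strictly_concave_kernel K ->
  (cond_infty' K \/ (C1_open K /\ C1_open L)) ->
  exists w : nat -> R,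
    inT n w /\
    supF L K n w = bigM L K n /\
    (* uniqueness up to permutation of coordinates *)
    (forall w', inT n w' -> supF L K n w' = bigM L K n ->
       exists s, perm_on n s /\ forall j, (1 <= j <= n)%nat -> w' j = w (s j)) /\
    (* (a) *)
    (forall i j, (i <= n)%nat -> (j <= n)%nat -> i <> j -> ext n w i <> ext n w j) /\
    (forall s, is_sorting n w s ->
       forall k, (k <= n)%nat -> msig L K n w s k = msig L K n w s 0) /\
    (* (b) *)
    bigM L K n = infB (inT n) (mbar_intervals L K n) /\
    infB (inT n) (mbar_intervals L K n) = supB (inT n) (munder L K n) /\
    supB (inT n) (munder L K n) = smallm L K n /\
    (* (c) *)
    (forall x y, inT n x -> inT n y ->
       Rbar_le (munder L K n x) (smallm L K n) /\
       smallm L K n = bigM L K n /\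
       Rbar_le (bigM L K n) (supF L K n y)) /\
    (* (d) *)
    (L = K -> exists s, perm_on n s /\
       forall j, (1 <= j <= n)%nat -> w (s j) = 2 * PI * INR j / INR (S n)).
Proof.
intros SL SK HC. pose proof SL as [HL _]; pose proof SK as [HK _].
destruct (minimal_exists L K n HL HK) as (m & w0 & Hw0 & Hmin0).
destruct (sorting_exists n w0 Hw0) as [s0 Hs0]. apply is_sorting_sorted in Hs0. destruct Hs0 as [Hp0 Hs].
(* By symmetry of [expF] in the nodes the sorted vector is again minimal, so the witness itself may
   be taken sorted. *)
set (w := fun i => w0 (s0 i)) in *.
assert (Hmin : minimal L K n m w) by exact (minimal_perm L K n m w0 s0 HL HK Hp0 Hmin0).
assert (Hw : inT n w) by exact (inT_perm n w0 s0 Hp0 Hw0).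
clearbody w. clear w0 Hw0 Hmin0 s0 Hp0.
pose proof Hmin as (Hm & Hmax & Hlow).
pose proof (minimal_equioscillation L K n m w SL SK HC Hmin Hw Hs) as Hequi.
assert (Hstep : forall j, (j <= n)%nat -> ext n w j < ext n w (S j)) by (intros j Hj; now apply Hequi).
assert (HsupF : forall y, Rbar_le (Finite (ln m)) (supF L K n y)).
{ intros y. destruct (supF_attained L K n y HL HK) as (z & _ & -> & Hz). destruct (Hlow y) as [t Ht].
  apply ebar_le; [easy|now apply F_not_p|]. simpl. rewrite exp_ln by easy.
  apply Rle_trans with (1 := Ht). apply Hz. }
assert (Hsupw : supF L K n w = Finite (ln m)).
{ destruct (supF_attained L K n w HL HK) as (z & _ & -> & Hz). apply F_eq_ln; auto.
  apply Rle_antisym; [apply Hmax|]. destruct (Hlow w) as [t Ht]. specialize (Hz t). lra. }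
assert (HbigM : bigM L K n = Finite (ln m)).
{ rewrite <- Hsupw. apply infB_attained; [easy|]. intros y _. rewrite Hsupw. apply HsupF. }
assert (Hmsig : forall s k, is_sorting n w s -> (k <= n)%nat -> msig L K n w s k = Finite (ln m)).
{ intros s k Hsort Hk. destruct (msig_attained L K n w s k HL HK Hsort Hk) as (z & Hz & -> & Hzmax).
  apply is_sorting_sorted in Hsort. destruct Hsort as [Hp Hsort].
  destruct (minimal_equioscillation L K n m (fun i => w (s i)) SL SK HC
    (minimal_perm L K n m w s HL HK Hp Hmin) (inT_perm n w s Hp Hw) Hsort k Hk) as [_ (z' & Hz' & E)].
  rewrite expF_perm in E by easy. apply F_eq_ln; auto. apply Rle_antisym; [apply Hmax|].
  rewrite <- E. now apply Hzmax. }
assert (Hunw : munder L K n w = Finite (ln m)).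
{ pose proof (sort_perm_sorting n w Hw) as Hsort. unfold munder.
  rewrite <- (Hmsig (sort_perm n w) 0%nat Hsort) by lia.
  apply (infB_attained (fun k => (k <= n)%nat)); [lia|]. intros k Hk. rewrite !Hmsig by (auto; lia). apply Rbar_le_refl. }
assert (Hunder : forall y, inT n y -> Rbar_le (munder L K n y) (Finite (ln m))).
{ intros y Hy. apply Rbar_not_lt_le. intros Hlt.
  pose proof (sort_perm_sorting n y Hy) as Hsort. set (s := sort_perm n y) in *.
  pose proof (proj1 (is_sorting_sorted n y s) Hsort) as [Hp Hsv].
  assert (Hall : forall k z, (k <= n)%nat -> msig L K n y s k = F L K n y z -> m < expF L K n y z).
  { intros k z Hk E.
    assert (Hle : Rbar_le (munder L K n y) (F L K n y z)).
    { rewrite <- E. now apply (infB_le (fun k => (k <= n)%nat) (msig L K n y s)). }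
    assert (Hlt' := Rbar_lt_le_trans _ _ _ Hlt Hle).
    apply Rnot_le_lt. intros Hge. apply (Rbar_lt_not_le _ _ Hlt').
    apply ebar_le; [now apply F_not_p|easy|]. simpl. now rewrite exp_ln. }
  (* Uniqueness identifies the sorted [y] with [w], yet the arc maxima of [y] all exceed [m], a
     level that [w] exceeds nowhere. *)
  assert (Heq : forall i, (1 <= i <= n)%nat -> y (s i) = w i).
  { apply (minimal_unique L K n m w (fun i => y (s i)) SL SK Hmin Hstep Hsv).
    intros j Hj. destruct (msig_attained L K n y s j HL HK Hsort Hj) as (z & Hz & E & _).
    exists z. split; [easy|]. rewrite expF_perm by easy. left. now apply (Hall j). }
  destruct (msig_attained L K n y s 0 HL HK Hsort ltac:(lia)) as (z & Hz & E & _).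
  specialize (Hall 0%nat z ltac:(lia) E). specialize (Hmax z).
  rewrite <- (expF_perm L K n y s) in Hall by easy.
  rewrite (expF_ext L K n (fun i => y (s i)) w) in Hall by easy. lra. }
assert (Hsmall : smallm L K n = Finite (ln m)).
{ rewrite <- Hunw. apply supB_attained; [easy|]. intros y Hy. rewrite Hunw. now apply Hunder. }
assert (Hmbar : infB (inT n) (mbar_intervals L K n) = Finite (ln m)).
{ rewrite <- Hsupw, <- (mbar_intervals_supF L K n w HL HK Hw). apply infB_attained; [easy|].
  intros y Hy. rewrite !mbar_intervals_supF, Hsupw by easy. apply HsupF. }
assert (Hdist : forall i j, (i < j <= n)%nat -> ext n w i < ext n w j).
{ intros i j Hij. apply Rlt_le_trans with (ext n w (S i)); [apply Hstep; lia|].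
  apply sorted_mono; [easy|lia]. }
exists w. split; [easy|]. split; [congruence|]. split; [|split; [|split; [|split; [|split; [|split; [|split]]]]]].
- intros w' Hw' E. rewrite HbigM in E.
  assert (Hmin' : minimal L K n m w').
  { split; [easy|]. split; [|easy]. intros t.
    destruct (supF_attained L K n w' HL HK) as (z & _ & Ez & Hz). rewrite Ez in E.
    apply F_eq_ln in E; auto. specialize (Hz t). lra. }
  destruct (sorting_exists n w' Hw') as [s Hsort]. apply is_sorting_sorted in Hsort. destruct Hsort as [Hp Hsort].
  pose proof (minimal_equioscillation L K n m (fun i => w' (s i)) SL SK HC
    (minimal_perm L K n m w' s HL HK Hp Hmin') (inT_perm n w' s Hp Hw') Hsort) as Hequi'.
  assert (Heq : forall i, (1 <= i <= n)%nat -> w' (s i) = w i).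
  { apply (minimal_unique L K n m w (fun i => w' (s i)) SL SK Hmin Hstep Hsort).
    intros j Hj. destruct (Hequi' j Hj) as [_ (z & Hz & Ez)]. exists z. split; [easy|lra]. }
  destruct (perm_on_inverse n s Hp) as (s' & Hp' & Hinv). exists s'. split; [easy|].
  intros j Hj. rewrite <- Heq by now apply Hp'. now rewrite Hinv.
- intros i j Hi Hj Hne. destruct (Nat.lt_total i j) as [H|[H|H]]; [|easy|].
  + assert (ext n w i < ext n w j) by (apply Hdist; lia). lra.
  + assert (ext n w j < ext n w i) by (apply Hdist; lia). lra.
- intros s Hsort k Hk. rewrite !Hmsig by (auto; lia). reflexivity.
- congruence.
- fold (smallm L K n). congruence.
- reflexivity.
- intros x y Hx Hy. rewrite Hsmall, HbigM. split; [now apply Hunder|]. split; [reflexivity|apply HsupF].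
- intros E. subst L. exists (fun j => j). split; [split; auto|].
  intros j Hj. now apply (minimal_equidistant K n m w).
Qed.
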